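(* For any $n\times n$ skew-symmetrizable matrix $B$ and any mutation data $(\mathbf d,\mathbf z)$, every $c$-vector $c^t_i$ ($t$ a vertex of $\mathbb T_n$, $1\le i\le n$) of the $(\mathbf d,\mathbf z)$-cluster pattern with principal coefficients and initial seed $(\mathbf x,\mathbf y,B)$ is sign-coherent: it is nonzero and its components are either all nonnegative or all nonpositive.
   Context: $[a]_+=\max(a,0)$; all matrices integer; $B=(b_{ij})$ skew-symmetrizable means positive integers $\delta_i$ with $\delta_ib_{ij}=-\delta_jb_{ji}$ exist. Mutation data: positive integers $\mathbf d=(d_1,\dots,d_n)$ and frozen coefficients $z_{i,s}$ ($1\le s\le d_i-1$), $z_{i,s}=z_{i,d_i-s}$, $z_{i,0}=z_{i,d_i}=1$. For formal variables $y_1,\dots,y_n$, $z_{i,s}$, $\mathrm{Trop}(\mathbf y,\mathbf z)$ is the free abelian multiplicative group they generate with $\oplus$ the componentwise minimum of exponents. The $(\mathbf d,\mathbf z)$-mutation at $k$ acts on exchange matrices and $y$-variables by: $b'_{ij}=-b_{ij}$ if $i=k$ or $j=k$, else $b'_{ij}=b_{ij}+d_k([-b_{ik}]_+b_{kj}+b_{ik}[b_{kj}]_+)$; $y'_k=y_k^{-1}$, $y'_i=y_i(y_k^{[\varepsilon b_{ki}]_+})^{d_k}(\bigoplus_{s=0}^{d_k}z_{k,s}y_k^{\varepsilon s})^{-b_{ki}}$ ($i\ne k$), $\varepsilon=\pm1$ (cluster variables also mutate, irrelevant here). $\mathbb T_n$ is the $n$-regular tree with edges labeled $1,\dots,n$,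 distinct labels at each vertex; the pattern with principal coefficients assigns seeds in $\mathrm{Trop}(\mathbf y,\mathbf z)$ to vertices, related by mutation at $k$ along edges labeled $k$, with $B$ and $y$-variables $y_1,\dots,y_n$ (the generators) at a fixed vertex $t_0$. Each $y$-variable $y^t_j$ is a Laurent monomial $\prod_iy_i^{c^t_{ij}}$ in $\mathbf y$ alone, and $c^t_j=(c^t_{1j},\dots,c^t_{nj})$ is the $c$-vector. *)

(* Defs.v *)
From HB Require Import structures.
From mathcomp Require Import all_boot all_order all_algebra.
Set Implicit Arguments. Unset Strict Implicit. Unset Printing Implicit Defensive.
Import Order.TTheory GRing.Theory Num.Theory.
Local Open Scope ring_scope.

Definition pospart (a : int) : int := if 0 <= a then a else 0.

(* An element of Trop(y,z): a Laurent monomial prod_i y_i^{yexp i} *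
   prod_{i,s} z_{i,s}^{zexp i s}.  Only finitely many (i,s) are ever used
   (1 <= s <= d_i/2 after identifying z_{i,s} = z_{i,d_i-s}). *)
Record trop (n : nat) := Trop { yexp : 'I_n -> int ; zexp : 'I_n -> nat -> int }.

Definition tone n : trop n := Trop (fun _ => 0) (fun _ _ => 0).
Definition tmul n (a b : trop n) : trop n :=
  Trop (fun i => yexp a i + yexp b i) (fun i s => zexp a i s + zexp b i s).
Definition tpow n (a : trop n) (e : int) : trop n :=
  Trop (fun i => yexp a i * e) (fun i s => zexp a i s * e).
Definition tplus n (a b : trop n) : trop n :=
  Trop (fun i => Num.min (yexp a i) (yexp b i))
       (fun i s => Num.min (zexp a i s) (zexp b i s)).

Definition ygen n (j : 'I_n) : trop n :=
  Trop (fun i => (i == j)%:Z) (fun _ _ => 0).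

(* frozen coefficient z_{k,s}: a generator for 1 <= s <= d_k - 1 with
   z_{k,s} = z_{k,d_k - s}; z_{k,0} = z_{k,d_k} = 1. *)
Definition zgen n (d : 'I_n -> nat) (k : 'I_n) (s : nat) : trop n :=
  if (0 < s < d k)%N then
    Trop (fun _ => 0) (fun i t => ((i == k) && (t == minn s (d k - s))%N)%:Z)
  else tone n.

Definition mutB n (d : 'I_n -> nat) (k : 'I_n) (B : 'M[int]_n) : 'M[int]_n :=
  \matrix_(i, j) if (i == k) || (j == k) then - B i j
                 else B i j + (d k)%:Z * (pospart (- B i k) * B k j
                                          + B i k * pospart (B k j)).

Definition sgnz (eps : bool) : int := if eps then 1 else -1.

Definition zsum n (d : 'I_n -> nat) (eps : bool) (k : 'I_n) (yk : trop n) : trop n :=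
  foldr (@tplus n) (tmul (zgen d k 0) (tpow yk 0))
        [seq tmul (zgen d k s) (tpow yk (sgnz eps * s%:Z)) | s <- iota 1 (d k)].

Definition mutY n (d : 'I_n -> nat) (eps : bool) (k : 'I_n) (B : 'M[int]_n)
    (Y : 'I_n -> trop n) : 'I_n -> trop n :=
  fun i => if i == k then tpow (Y k) (-1)
           else tmul (tmul (Y i)
                   (tpow (tpow (Y k) (pospart (sgnz eps * B k i))) (d k)%:Z))
                 (tpow (zsum d eps k (Y k)) (- B k i)).

Definition seed n := ('M[int]_n * ('I_n -> trop n))%type.

Definition mutate n (d : 'I_n -> nat) (eps : bool) (k : 'I_n) (sd : seed n) : seed n :=
  (mutB d k sd.1, mutY d eps k sd.1 sd.2).

(* Vertices t of the n-regular tree T_n correspond bijectively to the label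
   sequences of the path from t0 to t: sequences with no two consecutive
   equal labels. *)
Definition tree_vertex n (ks : seq 'I_n) : bool := sorted (fun a b => a != b) ks.

Definition seed_at n (d : 'I_n -> nat) (eps : bool) (B : 'M[int]_n)
    (ks : seq 'I_n) : seed n :=
  foldl (fun sd k => mutate d eps k sd) (B, @ygen n) ks.

Definition cvec n (d : 'I_n -> nat) (eps : bool) (B : 'M[int]_n)
    (ks : seq 'I_n) (j : 'I_n) : 'I_n -> int :=
  yexp ((seed_at d eps B ks).2 j).

Definition skew_symmetrizable n (B : 'M[int]_n) : Prop :=
  exists delta : 'I_n -> nat, (forall i, (0 < delta i)%N) /\
    forall i j, (delta i)%:Z * B i j = - ((delta j)%:Z * B j i).

Definition sign_coherent n (c : 'I_n -> int) : Prop :=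
  (exists i, c i != 0) /\ ((forall i, 0 <= c i) \/ (forall i, c i <= 0)).

(* Main.v *)
Require Import Defs.
From HB Require Import structures.
From mathcomp Require Import all_boot all_order all_algebra.
From mathcomp Require Import boolp.
From mathcomp Require Import zify ring lra.
Set Implicit Arguments. Unset Strict Implicit. Unset Printing Implicit Defensive.
Import Order.TTheory GRing.Theory Num.Theory.
Local Open Scope ring_scope.

(** On y-exponents the mutation rule is the classical c-vector mutation for the
    matrix (d_i b_ij), so the claim is sign-coherence of ordinary c-vectors.

    Work in a completed quantum torus X^a X^b = q^(w(a,b)) X^(a+b) graded by the
    cone spanned by the initial basis e_i of a lattice, w(e_i,e_j) = - delta_i b_ij.
    Every series g with constant term 1 factors uniquely, for a linear form th, as
    g = g_+ g_0 g_- with supports in th > 0, th = 0, th < 0; the map th |-> g_0 is a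
    consistent scattering diagram.  Prescribing quantum dilogarithms on the axes
    and no further "incoming" part, namely that the X^n-coefficient of
    log g_0 at th = w(n,.) vanishes off the axes, singles out one g.

    The mutation at k is a tilt: g = Psi_k h, and h Psi_k' (Psi_k' the dilogarithm
    of X_k^(-1)) is the series attached to the mutated basis.  Hence the
    g_0 of the two seeds agree on th(e_k) > 0, and on th(e_k) < 0 up to a shear.
    Transporting the positive chamber along a path of mutations shows that
    the c-vectors at t are normal to the facets of a chamber on which g_0 = 1, and that
    on each facet g_0 has a nonzero coefficient at plus or minus the c-vector.  As g_0 is
    supported in the positive cone, the c-vector is sign-coherent. *)

(** * Twisted series rings over a cone *)

(** The obstacle is that the two series related by a tilt live in completions along different cones,
    so they can be compared only through something supported in both. Hence g is not constructed
    directly. The unknown is a series u supported on the [reduced] exponents; both sides of the tilt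
    are recovered from it by multiplying each line n + Z e_k by a finite palindromic q-binomial
    polynomial, which is insensitive to replacing e_k by -e_k. Restricting the unknown in this way
    is harmless because the conditions at all other exponents hold automatically ([cluster_ex]), and
    factorisations can be carried between completions because the factors never leave the
    intersection of the cones ([rel_zer]). Along a path, the claims for a word starting with k at E
    are deduced from those for its tail at the mutated basis. They are therefore proved for all
    bases at once, and vectors are mutated by a rule that makes sense before sign-coherence is
    known. *)

Record bichar (M : zmodType) (K : realFieldType) := Bichar {
  bich :> M -> M -> K;
  bichDl : forall a b c, bich (a + b) c = bich a c * bich b c;
  bichDr : forall a b c, bich a (b + c) = bich a b * bich a c;
  bich_neq0 : forall a b, bich a b != 0 }.

(** [cdec n] lists all splittings of n inside the cone, so every coefficient of a product is a
    finite sum. The degree, additive and zero only at 0, is the filtration along which all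
    recursions below converge. *)
Record cone (M : zmodType) := Cone {
  cmem : pred M;
  cdec : M -> seq M;
  cdeg : M -> nat;
  cdec_uniq : forall n, uniq (cdec n);
  mem_cdec : forall m n, (m \in cdec n) = cmem m && cmem (n - m);
  cmem0 : cmem 0;
  cmemD : forall a b, cmem a -> cmem b -> cmem (a + b);
  cdegD : forall a b, cmem a -> cmem b -> cdeg (a + b) = (cdeg a + cdeg b)%N;
  cdeg_eq0 : forall a, cmem a -> cdeg a = 0%N -> a = 0 }.

(* f : ser chi S stands for the formal sum of the f n X^n over the cone S, with
   X^a X^b = chi a b X^(a+b). *)
Record ser (M : zmodType) (K : realFieldType) (chi : bichar M K) (S : cone M) :=
  Ser { cf :> M -> K; cf_supp : forall n, ~~ cmem S n -> cf n = 0 }.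

Section Series.
Variables (M : zmodType) (K : realFieldType) (chi : bichar M K) (S : cone M).

Lemma bich0l a : chi 0 a = 1.
Proof.
have := bichDl chi 0 0 a; rewrite addr0 => /eqP.
rewrite -{1}[chi 0 a]mulr1 (inj_eq (mulfI (bich_neq0 chi 0 a))) => /eqP <-.
by [].
Qed.

Lemma bich0r a : chi a 0 = 1.
Proof.
have := bichDr chi a 0 0; rewrite addr0 => /eqP.
rewrite -{1}[chi a 0]mulr1 (inj_eq (mulfI (bich_neq0 chi a 0))) => /eqP <-.
by [].
Qed.

Notation ser := (ser chi S).

Lemma serP (f g : ser) : (forall n, cf f n = cf g n) -> f = g.
Proof.
case: f g => [f hf] [g hg] /= e; have {}e : f = g by apply/funext.
by subst g; congr Ser; apply: Prop_irrelevance.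
Qed.

Lemma cf_mem (f : ser) n : f n != 0 -> cmem S n.
Proof. by apply: contraNT => h; rewrite cf_supp. Qed.

Lemma ser_res_supp (f : M -> K) n :
  ~~ cmem S n -> (if cmem S n then f n else 0) = 0.
Proof. by move/negPf=> ->. Qed.

Fact ser_res_key : unit. Proof. by []. Qed.

Definition ser_res (f : M -> K) : ser :=
  locked_with ser_res_key (@Ser _ _ chi S _ (@ser_res_supp f)).

Lemma ser_resE (f : M -> K) n : ser_res f n = if cmem S n then f n else 0.
Proof. by rewrite /ser_res unlock. Qed.

Definition ser_add (f g : ser) := ser_res (fun n => f n + g n).
Definition ser_opp (f : ser) := ser_res (fun n => - f n).
Definition ser_zero := ser_res (fun _ => 0).
Definition ser_one := ser_res (fun n => (n == 0)%:R).
Definition ser_conv (f g : M -> K) n :=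
  \sum_(m <- cdec S n) f m * g (n - m) * chi m (n - m).
Definition ser_mul (f g : ser) := ser_res (ser_conv f g).

HB.instance Definition _ := gen_eqMixin ser.
HB.instance Definition _ := gen_choiceMixin ser.

Lemma ser_addE f g n : ser_add f g n = f n + g n.
Proof. by rewrite /ser_add ser_resE; case: ifPn => // h; rewrite !cf_supp // addr0. Qed.

Lemma ser_oppE f n : ser_opp f n = - f n.
Proof. by rewrite /ser_opp ser_resE; case: ifPn => // h; rewrite !cf_supp // oppr0. Qed.

Lemma ser_zeroE n : ser_zero n = 0.
Proof. by rewrite /ser_zero ser_resE; case: ifP. Qed.

Lemma ser_oneE n : ser_one n = (n == 0)%:R.
Proof. by rewrite /ser_one ser_resE; case: ifPn => //; case: eqP => // ->; rewrite cmem0. Qed.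

Lemma cdec_out n : ~~ cmem S n -> cdec S n = [::].
Proof.
move=> h; case E: (cdec S n) => [//|m s].
have: m \in cdec S n by rewrite E mem_head.
rewrite mem_cdec => /andP[h1 h2]; case/negP: h.
by rewrite -(subrK m n) cmemD.
Qed.

Lemma ser_mulE f g n : ser_mul f g n = ser_conv f g n.
Proof.
by rewrite /ser_mul ser_resE; case: ifPn => // h; rewrite /ser_conv cdec_out // big_nil.
Qed.

Lemma ser_addrA : associative ser_add.
Proof. by move=> f g h; apply: serP => n; rewrite !ser_addE addrA. Qed.
Lemma ser_addrC : commutative ser_add.
Proof. by move=> f g; apply: serP => n; rewrite !ser_addE addrC. Qed.
Lemma ser_add0r : left_id ser_zero ser_add.
Proof. by move=> f; apply: serP => n; rewrite ser_addE ser_zeroE add0r. Qed.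
Lemma ser_addNr : left_inverse ser_zero ser_opp ser_add.
Proof. by move=> f; apply: serP => n; rewrite ser_addE ser_oppE ser_zeroE addNr. Qed.

HB.instance Definition _ := GRing.isZmodule.Build ser
  ser_addrA ser_addrC ser_add0r ser_addNr.

Lemma ser_mulrA : associative ser_mul.
Proof.
move=> f g h; apply: serP => n; rewrite !ser_mulE /ser_conv.
(* Both sides sum over ordered triples of cone elements with sum n, recorded by the first two
   entries: [L] chooses the first entry first, [R] the sum p of the first two. *)
pose L := [seq (m, r) | m <- cdec S n, r <- cdec S (n - m)].
pose R := [seq (m, p - m) | p <- cdec S n, m <- cdec S p].
pose F (x : M * M) := f x.1 * g x.2 * h (n - x.1 - x.2) *
   (chi x.1 x.2 * chi x.1 (n - x.1 - x.2) * chi x.2 (n - x.1 - x.2)).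
transitivity (\sum_(x <- L) F x).
  rewrite /L big_allpairs_dep /=; apply: eq_bigr => m _.
  rewrite ser_mulE /ser_conv mulr_sumr mulr_suml; apply: eq_bigr => r _ /=.
  rewrite /F /=; have -> : chi m (n - m) = chi m r * chi m (n - m - r).
    by rewrite -bichDr [r + _]addrC subrK.
  by ring.
transitivity (\sum_(x <- R) F x); last first.
  rewrite /R big_allpairs_dep /=; apply: eq_bigr => p _.
  rewrite ser_mulE /ser_conv !mulr_suml; apply: eq_bigr => m _ /=.
  rewrite /F /=.
  have -> : n - m - (p - m) = n - p by rewrite opprB addrA subrK.
  have -> : chi p (n - p) = chi (p - m) (n - p) * chi m (n - p).
    by rewrite -bichDl subrK.
  by ring.
apply: perm_big; apply: uniq_perm.
- apply: allpairs_uniq_dep => [|x _|]; rewrite ?cdec_uniq //.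
  by move=> [x y] [x' y'] _ _ /= [-> ->].
- apply: allpairs_uniq_dep => [|x _|]; rewrite ?cdec_uniq //.
  by move=> [x y] [x' y'] _ _ /= [-> /addIr ->].
move=> [m r]; apply/allpairsPdep/allpairsPdep.
- move=> [m' [r' [h1 h2 [-> ->]]]]; exists (m' + r'), m'.
  rewrite mem_cdec in h1; rewrite mem_cdec in h2.
  case/andP: h1 => h11 h12; case/andP: h2 => h21 h22.
  rewrite !mem_cdec; split.
  + by rewrite opprD addrA h22 andbT cmemD.
  + by rewrite h11 addrAC subrr add0r.
  + by rewrite (addrAC m') subrr add0r.
- move=> [p [m' [h1 h2 [-> ->]]]]; exists m', (p - m').
  rewrite mem_cdec in h1; rewrite mem_cdec in h2.
  case/andP: h1 => h11 h12; case/andP: h2 => h21 h22.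
  rewrite !mem_cdec; split => //.
  + rewrite h21 /=; have -> : n - m' = (n - p) + (p - m') by rewrite addrA subrK.
    by rewrite cmemD.
  + by rewrite h22 /= opprB addrA subrK.
Qed.

Lemma mem0_cdec n : (0 \in cdec S n) = cmem S n.
Proof. by rewrite mem_cdec cmem0 subr0. Qed.
Lemma memn_cdec n : (n \in cdec S n) = cmem S n.
Proof. by rewrite mem_cdec subrr cmem0 andbT. Qed.

Lemma ser_mul1r : left_id ser_one ser_mul.
Proof.
move=> f; apply: serP => n; rewrite ser_mulE /ser_conv.
case: (boolP (cmem S n)) => h; last by rewrite cdec_out // big_nil cf_supp.
rewrite (bigD1_seq 0) ?cdec_uniq ?mem0_cdec //= big1 => [|m /negPf m0].
  by rewrite ser_oneE eqxx mul1r subr0 bich0l mulr1 addr0.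
by rewrite ser_oneE m0 !mul0r.
Qed.

Lemma ser_mulr1 : right_id ser_one ser_mul.
Proof.
move=> f; apply: serP => n; rewrite ser_mulE /ser_conv.
case: (boolP (cmem S n)) => h; last by rewrite cdec_out // big_nil cf_supp.
rewrite (bigD1_seq n) ?cdec_uniq ?memn_cdec //= big1 => [|m /negPf m0].
  by rewrite ser_oneE subrr eqxx mulr1 bich0r mulr1 addr0.
by rewrite ser_oneE subr_eq0 eq_sym m0 mulr0 mul0r.
Qed.

Lemma ser_mulrDl : left_distributive ser_mul +%R.
Proof.
move=> f g h; apply: serP => n.
rewrite -[RHS]/(ser_add _ _ n) ser_addE !ser_mulE /ser_conv -big_split /=.
by apply: eq_bigr => m _; rewrite -[(f + g) m]/(ser_add f g m) ser_addE !mulrDl.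
Qed.

Lemma ser_mulrDr : right_distributive ser_mul +%R.
Proof.
move=> f g h; apply: serP => n.
rewrite -[RHS]/(ser_add _ _ n) ser_addE !ser_mulE /ser_conv -big_split /=.
apply: eq_bigr => m _; rewrite -[(g + h) _]/(ser_add g h (n - m)) ser_addE.
by rewrite mulrDr mulrDl.
Qed.

HB.instance Definition _ := GRing.Zmodule_isPzRing.Build ser
  ser_mulrA ser_mul1r ser_mulr1 ser_mulrDl ser_mulrDr.

Lemma serDE (f g : ser) n : (f + g) n = f n + g n.
Proof. exact: ser_addE. Qed.
Lemma serNE (f : ser) n : (- f) n = - f n.
Proof. exact: ser_oppE. Qed.
Lemma serBE (f g : ser) n : (f - g) n = f n - g n.
Proof. by rewrite serDE serNE. Qed.
Lemma ser0E n : (0 : ser) n = 0.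
Proof. exact: ser_zeroE. Qed.
Lemma ser1E n : (1 : ser) n = (n == 0)%:R.
Proof. exact: ser_oneE. Qed.
Lemma serME (f g : ser) n : (f * g) n =
  \sum_(m <- cdec S n) f m * g (n - m) * chi m (n - m).
Proof. exact: ser_mulE. Qed.
End Series.

(** * Factorisation along a linear form *)

Section Factorisation.
Variables (M : zmodType) (K : realFieldType) (chi : bichar M K) (S : cone M).
Notation ser := (ser chi S).
Implicit Types (f g u v a b x : ser) (n m : M) (d : nat) (p P : pred M).

Lemma cdec_degE m n : m \in cdec S n ->
  cdeg S n = (cdeg S m + cdeg S (n - m))%N.
Proof.
rewrite mem_cdec => /andP[h1 h2].
by rewrite -cdegD // addrC subrK.
Qed.

Lemma cdec_deg_lt m n : m \in cdec S n -> m != 0 -> (cdeg S (n - m) < cdeg S n)%N.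
Proof.
move=> h m0; rewrite (cdec_degE h) -[X in (X < _)%N]add0n ltn_add2r lt0n.
apply: contra m0 => /eqP e; apply/eqP; apply: cdeg_eq0 e.
by move: h; rewrite mem_cdec => /andP[].
Qed.

Lemma cdec_deg_lt2 m n : m \in cdec S n -> n - m != 0 -> (cdeg S m < cdeg S n)%N.
Proof.
move=> h m0; rewrite (cdec_degE h) -[X in (X < _)%N]addn0 ltn_add2l lt0n.
apply: contra m0 => /eqP e; apply/eqP; apply: cdeg_eq0 e.
by move: h; rewrite mem_cdec => /andP[].
Qed.

Lemma cdeg0 : cdeg S 0 = 0%N.
Proof. by have := cdegD (cmem0 S) (cmem0 S); rewrite addr0; lia. Qed.

Definition low d f := forall n, (cdeg S n < d)%N -> f n = 0.

Lemma mul_lowr f g d n : low d g -> (cdeg S n <= d)%N -> (f * g) n = f 0 * g n.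
Proof.
move=> hg hn; rewrite serME; case: (boolP (cmem S n)) => h; last first.
  by rewrite cdec_out // big_nil (cf_supp g) // mulr0.
rewrite (bigD1_seq 0) ?cdec_uniq ?mem0_cdec //= big_seq_cond big1.
  by rewrite subr0 bich0l mulr1 addr0.
move=> m /andP[h1 h2]; rewrite hg ?mulr0 ?mul0r //.
exact: leq_trans (cdec_deg_lt h1 h2) hn.
Qed.

Lemma mul_lowl f g d n : low d f -> (cdeg S n <= d)%N -> (f * g) n = f n * g 0.
Proof.
move=> hf hn; rewrite serME; case: (boolP (cmem S n)) => h; last first.
  by rewrite cdec_out // big_nil (cf_supp f) // mul0r.
rewrite (bigD1_seq n) ?cdec_uniq ?memn_cdec //= big_seq_cond big1.
  by rewrite subrr bich0r mulr1 addr0.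
move=> m /andP[h1 h2]; rewrite hf ?mul0r //.
apply: leq_trans hn; apply: cdec_deg_lt2 h1 _.
by rewrite subr_eq0 eq_sym.
Qed.

Lemma ser0M f g : (f * g) 0 = f 0 * g 0.
Proof. by apply: (@mul_lowr _ _ 0%N); rewrite ?cdeg0. Qed.

(** Leibniz rule to leading order: up to degree d only the constant terms of the other factors
    survive. *)
Lemma mulB_top f f' g g' d n : low d (f - f') -> low d (g - g') ->
  (cdeg S n <= d)%N ->
  (f * g - f' * g') n = f 0 * (g n - g' n) + (f n - f' n) * g' 0.
Proof.
move=> hf hg hn.
have -> : f * g - f' * g' = f * (g - g') + (f - f') * g'.
  by rewrite mulrBr mulrBl addrA subrK.
by rewrite serDE (mul_lowr _ hg) // (mul_lowl _ hf) // !serBE.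
Qed.

Lemma low0 f : low 0 f. Proof. by []. Qed.

Lemma low_eq f g : (forall d, low d (f - g)) -> f = g.
Proof.
move=> h; apply: serP => n; apply/eqP; rewrite -subr_eq0 -serBE.
by rewrite (h (cdeg S n).+1).
Qed.

Definition contracting (F : ser -> ser) :=
  forall d u v, low d (u - v) -> low d.+1 (F u - F v).

(** Iterating from 0, coefficients of degree below j are final after j steps, so the limit reads a
    coefficient of degree j off the iterate j + 1. *)
Lemma contracting_fix F : contracting F -> exists u, F u = u.
Proof.
move=> hF; pose it j := iter j F 0.
have it_low j i : low j (it (j + i)%N - it j).
  by elim: j => [|j IH]; [exact: low0 | apply: hF].
pose u : ser := ser_res chi S (fun n => it (cdeg S n).+1 n).
have uE n : u n = it (cdeg S n).+1 n.
  rewrite ser_resE; case: ifPn => // h.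
  by rewrite cf_supp.
have hu d : low d (u - it d).
  move=> n hn; rewrite serBE uE; apply/eqP; rewrite subr_eq0 eq_sym -subr_eq0.
  by rewrite -serBE -(subnKC hn) it_low.
exists u; apply: low_eq => d n hn.
have -> : F u - u = (F u - F (it d)) - (u - it d.+1) by rewrite opprB addrA subrK.
by rewrite serBE (hF _ _ _ (hu d)) ?(hu d.+1) ?subr0 // ltnS ltnW.
Qed.

Lemma contracting_uniq F u v : contracting F -> F u = u -> F v = v -> u = v.
Proof.
move=> hF hu hv; apply: low_eq; elim=> [|d IH]; first exact: low0.
by rewrite -hu -hv; apply: hF.
Qed.

Definition proj p f : ser := ser_res chi S (fun n => if (n != 0) && p n then f n else 0).

Lemma projE p f n : proj p f n = if (n != 0) && p n then f n else 0.
Proof.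
by rewrite ser_resE; case: ifPn => // h; case: ifP => // _; rewrite cf_supp.
Qed.

Lemma proj0 p f : proj p f 0 = 0. Proof. by rewrite projE eqxx. Qed.

Lemma proj_low p d f g : low d (f - g) -> low d (proj p f - proj p g).
Proof.
move=> h n hn; rewrite serBE !projE; case: ifP => _; rewrite ?subrr //.
by rewrite -serBE h.
Qed.

Definition uni p f := f 0 = 1 /\ forall n, n != 0 -> f n != 0 -> p n.

Lemma uni_sub p P f : (forall n, n != 0 -> cmem S n -> p n -> P n) -> uni p f -> uni P f.
Proof.
move=> h [h0 hf]; split=> // n n0 fn; apply: h => //; last exact: hf.
exact: cf_mem fn.
Qed.

Lemma mul_neq0 f g n : (f * g) n != 0 ->
  exists m, [/\ m \in cdec S n, f m != 0 & g (n - m) != 0].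
Proof.
move=> h; apply: contrapT => hn; case/negP: h; apply/eqP.
rewrite serME big_seq big1 // => m hm.
case: (eqVneq (f m) 0) => [->|fm]; first by rewrite !mul0r.
case: (eqVneq (g (n - m)) 0) => [->|gm]; first by rewrite mulr0 mul0r.
by case: hn; exists m.
Qed.

Definition aclosed p := forall n m, p n -> p m -> p (n + m).

Lemma uniM p f g : aclosed p -> uni p f -> uni p g -> uni p (f * g).
Proof.
move=> hp [f0 hf] [g0 hg]; split=> [|n n0]; first by rewrite ser0M f0 g0 mulr1.
move=> /mul_neq0[m [hm fm gm]].
case: (eqVneq m 0) => [m0|m0]; first by apply: hg => //; rewrite m0 subr0 in gm.
case: (eqVneq (n - m) 0) => [e|e].
  by move/eqP: e fm; rewrite subr_eq0 => /eqP <-; apply: hf.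
by rewrite -(subrK m n); apply: hp; [apply: hg|apply: hf].
Qed.

Lemma uni_proj p f : uni p f -> proj p (f - 1) = f - 1.
Proof.
move=> [f0 hf]; apply: serP => n; rewrite projE serBE ser1E.
case: eqVneq => /= [->|n0]; first by rewrite f0 subrr.
rewrite subr0; case: ifPn => // hp; case: (eqVneq (f n) 0) => // fn.
by rewrite hf in hp.
Qed.

Lemma uni_projC p f : uni (predC p) f -> proj p (f - 1) = 0.
Proof.
move=> [f0 hf]; apply: serP => n; rewrite projE serBE ser1E ser0E.
case: eqVneq => //= n0; case: ifPn => // hp; rewrite subr0.
by case: (eqVneq (f n) 0) => // fn; have := hf _ n0 fn; rewrite /= hp.
Qed.

Lemma projD p f g : proj p (f + g) = proj p f + proj p g.
Proof.
apply: serP => n; rewrite serDE !projE serDE; case: ifP => //.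
by rewrite addr0.
Qed.

(** With [u = (a - 1) + (b - 1)], the equation [f = a * b] becomes
    [u = f - 1 - proj p u * proj (predC p) u], which is contracting because projections have no
    constant term. The same equation gives existence through [spl]. *)
Lemma uni_split_uniq p a b a' b' : uni p a -> uni (predC p) b ->
  uni p a' -> uni (predC p) b' -> a * b = a' * b' -> a = a' /\ b = b'.
Proof.
move=> ha hb ha' mut_compat e.
pose q := predC p.
pose F u := a * b - 1 - proj p u * proj q u.
have hF : contracting F.
  move=> d u v h n hn; rewrite /F.
  set s := a * b - 1.
  have -> : s - proj p u * proj q u - (s - proj p v * proj q v) =
            proj p v * proj q v - proj p u * proj q u.
    by apply: serP => m; rewrite !(serDE, serNE); ring.
  rewrite -opprB serNE (mulB_top (proj_low _ h) (proj_low _ h)) //.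
  by rewrite !proj0 mul0r mulr0 addr0 oppr0.
have pE x y : uni p x -> uni q y ->
    proj p ((x - 1) + (y - 1)) = x - 1 /\ proj q ((x - 1) + (y - 1)) = y - 1.
  move=> hx hy; rewrite ![proj _ (_ - 1 + _)]projD (uni_proj hx) (uni_projC hy) addr0; split=> //.
  rewrite (uni_proj hy) (@uni_projC q x) ?add0r //.
  by apply: uni_sub hx => n _ _ /=; rewrite negbK.
have fixE x y : uni p x -> uni q y -> x * y = a * b ->
    F ((x - 1) + (y - 1)) = (x - 1) + (y - 1).
  move=> hx hy exy; rewrite /F -exy; have [-> ->] := pE _ _ hx hy.
  rewrite mulrBl !mulrBr !mul1r !mulr1.
  by apply: serP => n; rewrite !(serDE, serNE); ring.
have E := contracting_uniq hF (fixE _ _ ha hb (erefl _)) (fixE _ _ ha' mut_compat (esym e)).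
have [e1 e2] := pE _ _ ha hb; have [e1' e2'] := pE _ _ ha' mut_compat.
split; apply: (addIr (- 1)).
  by rewrite -[LHS]e1 -[RHS]e1' E.
by rewrite -[LHS]e2 -[RHS]e2' E.
Qed.

Lemma split_contracting p f : contracting (fun u => f - 1 - proj p u * proj (predC p) u).
Proof.
move=> d u v h n hn.
set s := f - 1.
have -> : s - proj p u * proj (predC p) u - (s - proj p v * proj (predC p) v) =
          proj p v * proj (predC p) v - proj p u * proj (predC p) u.
  by apply: serP => m; rewrite !(serDE, serNE); ring.
rewrite -opprB serNE (mulB_top (proj_low _ h) (proj_low _ h)) //.
by rewrite !proj0 mul0r mulr0 addr0 oppr0.
Qed.

Definition spl p f : ser := projT1 (cid (contracting_fix (@split_contracting p f))).
Lemma splE p f : spl p f = f - 1 - proj p (spl p f) * proj (predC p) (spl p f).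
Proof. by rewrite /spl; case: cid. Qed.

Definition lft p f := 1 + proj p (spl p f).
Definition rgt p f := 1 + proj (predC p) (spl p f).

Lemma spl0 p f : f 0 = 1 -> spl p f 0 = 0.
Proof. by move=> f0; rewrite splE !serBE ser0M !proj0 ser1E eqxx f0 subrr mul0r subr0. Qed.

Lemma split_mul p f : f 0 = 1 -> f = lft p f * rgt p f.
Proof.
move=> f0; have h := spl0 p f0; have e := splE p f.
have eu : spl p f = proj p (spl p f) + proj (predC p) (spl p f).
  apply: serP => n; rewrite serDE !projE /=.
  by case: eqVneq => [->|_] /=; [rewrite h addr0 | case: (p n); rewrite ?addr0 ?add0r].
rewrite /lft /rgt mulrDl !mulrDr !mulr1 !mul1r.
apply: serP => n; have := congr1 (fun u : ser => u n) e; rewrite {1}eu.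
by rewrite !(serDE, serNE) => e'; lra.
Qed.

Lemma lft_uni p f : uni p (lft p f).
Proof.
split=> [|n n0]; first by rewrite serDE proj0 ser1E eqxx addr0.
by rewrite serDE ser1E (negPf n0) add0r projE n0 /=; case: (p n); rewrite ?eqxx.
Qed.

Lemma rgt_uni p f : uni (predC p) (rgt p f).
Proof.
split=> [|n n0]; first by rewrite serDE proj0 ser1E eqxx addr0.
by rewrite serDE ser1E (negPf n0) add0r projE n0 /=; case: (p n); rewrite ?eqxx.
Qed.

Lemma spl_supp p P f : aclosed P -> uni P f ->
  forall n, n != 0 -> spl p f n != 0 -> P n.
Proof.
move=> hP [f0 hf] n; move: {2}(cdeg S n) (leqnn (cdeg S n)) => d.
elim: d n => [|d IH] n hd n0 hn.
  by case/negP: n0; apply/eqP/(cdeg_eq0 (cf_mem hn)); lia.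
case: (eqVneq (f n) 0) => [fn|]; last exact: hf.
move: hn; rewrite splE !serBE ser1E (negPf n0) fn !sub0r oppr0 sub0r oppr_eq0.
case/mul_neq0=> m [hm]; rewrite !projE.
case: ifP => [/andP[m0 pm]|_]; last by rewrite eqxx.
move=> h1; case: ifP => [/andP[m1 pm1]|_]; last by rewrite eqxx.
move=> h2; rewrite -(subrK m n); apply: hP; apply: IH => //.
  by have := cdec_deg_lt hm m0; lia.
by have := cdec_deg_lt2 hm m1; lia.
Qed.

Lemma lft_supp p P f : aclosed P -> uni P f -> uni P (lft p f).
Proof.
move=> hP hf; split=> [|n n0]; first by case: (lft_uni p f).
rewrite serDE ser1E (negPf n0) add0r projE; case: ifP; rewrite ?eqxx // => _.
exact: spl_supp hP hf n n0.
Qed.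

Lemma rgt_supp p P f : aclosed P -> uni P f -> uni P (rgt p f).
Proof.
move=> hP hf; split=> [|n n0]; first by case: (rgt_uni p f).
rewrite serDE ser1E (negPf n0) add0r projE; case: ifP; rewrite ?eqxx // => _.
exact: spl_supp hP hf n n0.
Qed.

Lemma inv_contracting u : u 0 = 1 -> contracting (fun v => 1 - (u - 1) * v).
Proof.
move=> u0 d v w h n hn.
have -> : 1 - (u - 1) * v - (1 - (u - 1) * w) = - ((u - 1) * (v - w)).
  by rewrite mulrBr; apply: serP => m; rewrite !(serDE, serNE); ring.
by rewrite serNE (mul_lowr _ h) // [(u - 1) 0]serBE ser1E eqxx u0 subrr mul0r oppr0.
Qed.

(** The condition on the constant term sits under the existential so that [sinv] can be chosen for
    every series. *)
Lemma rinv_ex u : exists v, u 0 = 1 -> v 0 = 1 /\ u * v = 1.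
Proof.
case: (eqVneq (u 0) 1) => u0; last by exists 0 => e; rewrite e eqxx in u0.
have [v hv] := contracting_fix (inv_contracting u0).
have e : u * v = 1.
  apply: (addIr (- v)); rewrite -[in RHS]hv mulrBl mul1r.
  by apply: serP => m; rewrite !(serDE, serNE); ring.
exists v => _; split=> //.
by have := congr1 (fun f : ser => f 0) e; rewrite ser0M u0 mul1r ser1E eqxx.
Qed.

Definition sinv u : ser := projT1 (cid (rinv_ex u)).

Lemma sinv0 u : u 0 = 1 -> sinv u 0 = 1.
Proof. by rewrite /sinv; case: cid => v /= h /h[]. Qed.

Lemma mulrsV u : u 0 = 1 -> u * sinv u = 1.
Proof. by rewrite /sinv; case: cid => v /= h /h[]. Qed.

Lemma mulVrs u : u 0 = 1 -> sinv u * u = 1.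
Proof.
move=> u0; have e := mulrsV u0; have e' := mulrsV (sinv0 u0).
have eu : sinv (sinv u) = u by rewrite -[LHS]mul1r -e -mulrA e' mulr1.
by rewrite -{2}eu.
Qed.

Lemma sinv_uniq u v : u 0 = 1 -> u * v = 1 -> v = sinv u.
Proof. by move=> u0 e; rewrite -[v]mul1r -(mulVrs u0) -mulrA e mulr1. Qed.

Lemma sinv_supp P u : aclosed P -> uni P u -> uni P (sinv u).
Proof.
move=> hP [u0 hu]; split=> [|n]; first exact: sinv0.
move: {2}(cdeg S n) (leqnn (cdeg S n)) => d.
elim: d n => [|d IH] n hd n0 hn.
  by case/negP: n0; apply/eqP/(cdeg_eq0 (cf_mem hn)); lia.
move: hn; have -> : sinv u = 1 - (u - 1) * sinv u.
  rewrite mulrBl mul1r (mulrsV u0).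
  by apply: serP => m; rewrite !(serDE, serNE); ring.
rewrite serBE ser1E (negPf n0) sub0r oppr_eq0 => /mul_neq0[m [hm h1 h2]].
case: (eqVneq m 0) h1 => [->|m0]; first by rewrite serBE ser1E eqxx u0 subrr eqxx.
rewrite serBE ser1E (negPf m0) subr0 => h1.
case: (eqVneq (n - m) 0) => [e|e].
  by move/eqP: e h1; rewrite subr_eq0 => /eqP <-; apply: hu.
rewrite -(subrK m n); apply: hP; last exact: hu.
by apply: IH => //; have := cdec_deg_lt hm m0; lia.
Qed.

Definition lin (th : M -> int) := forall n m, th (n + m) = th n + th m.

Section Theta.
Variable th : M -> int.
Hypothesis hth : lin th.

(* the middle factor of f = f_+ f_0 f_- for the signs of th *)
Definition zer_part f := lft (fun n => 0 <= th n) (rgt (fun n => 0 < th n) f).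

Definition fac f x := exists a b, [/\ uni (fun n => 0 < th n) a,
  uni (fun n => th n == 0) x, uni (fun n => th n < 0) b & f = a * x * b].

Lemma gt_closed : aclosed (fun n => 0 < th n).
Proof. by move=> n m; rewrite hth; lia. Qed.
Lemma lt_closed : aclosed (fun n => th n < 0).
Proof. by move=> n m; rewrite hth; lia. Qed.
Lemma eq_closed : aclosed (fun n => th n == 0).
Proof. by move=> n m; rewrite hth; lia. Qed.
Lemma le_closed : aclosed (fun n => th n <= 0).
Proof. by move=> n m; rewrite hth; lia. Qed.

(** The factors are built from products of terms of f, so they stay in any set closed under
    addition. This is applied to [lo_bounded], [hi_bounded] and the intersection of two cones. *)
Lemma fac_supp P f : aclosed P -> uni P f -> exists a b,
  [/\ [/\ uni (fun n => 0 < th n) a,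
  uni (fun n => th n == 0) (zer_part f), uni (fun n => th n < 0) b &
  f = a * zer_part f * b], uni P a, uni P (zer_part f) & uni P b].
Proof.
move=> hP hf; rewrite /zer_part.
set p1 := fun n => 0 < th n; set p2 := fun n => 0 <= th n.
have f0 : f 0 = 1 by case: hf.
have y0 : rgt p1 f 0 = 1 by case: (rgt_uni p1 f).
have yle : uni (fun n => th n <= 0) (rgt p1 f).
  by apply: uni_sub (rgt_uni p1 f) => n _ _ /=; rewrite /p1; lia.
have yP := rgt_supp p1 hP hf.
exists (lft p1 f), (rgt p2 (rgt p1 f)); split; last 3 first.
- exact: lft_supp.
- exact: lft_supp.
- exact: rgt_supp.
split.
- exact: lft_uni.
- have [h0 h1] := lft_uni p2 (rgt p1 f).
  have [_ h2] := lft_supp p2 le_closed yle.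
  split=> // n n0 hn; have := h1 _ n0 hn; have := h2 _ n0 hn; rewrite /p2; lia.
- by apply: uni_sub (rgt_uni p2 _) => n _ _ /=; rewrite /p2; lia.
- by rewrite -mulrA -(split_mul p2 y0) -(split_mul p1 f0).
Qed.

Lemma uniT f : f 0 = 1 -> uni predT f.
Proof. by move=> f0; split. Qed.

Lemma zer_fac f : f 0 = 1 -> fac f (zer_part f).
Proof.
move=> f0; have [|a [b [h _ _ _]]] := @fac_supp predT f _ (uniT f0); first by [].
by exists a, b.
Qed.

Lemma fac_one f x : fac f x -> f 0 = 1.
Proof. by move=> [a [b [[a0 _] [x0 _] [b0 _] ->]]]; rewrite !ser0M a0 x0 b0 !mulr1. Qed.

Lemma fac_uniq f x y : fac f x -> fac f y -> x = y.
Proof.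
move=> [a [b [ha hx hb e]]] [a' [b' [ha' hy mut_compat e']]].
have aux z c : uni (fun n => th n == 0) z -> uni (fun n => th n < 0) c ->
    uni (predC (fun n => 0 < th n)) (z * c).
  move=> hz hc; have : uni (fun n => th n <= 0) (z * c).
    apply: uniM; first exact: le_closed.
      by apply: uni_sub hz => n _ _ /=; lia.
    by apply: uni_sub hc => n _ _ /=; lia.
  by apply: uni_sub => n _ _ /=; lia.
have [|_ exb] := uni_split_uniq ha (aux _ _ hx hb) ha' (aux _ _ hy mut_compat).
  by rewrite !mulrA -e.
have [] // := @uni_split_uniq (fun n => 0 <= th n) _ _ _ _ _ _ _ _ exb.
- by apply: uni_sub hx => n _ _ /=; lia.
- by apply: uni_sub hb => n _ _ /=; lia.
- by apply: uni_sub hy => n _ _ /=; lia.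
- by apply: uni_sub mut_compat => n _ _ /=; lia.
Qed.

Lemma zer_partE f x : fac f x -> zer_part f = x.
Proof. by move=> h; apply: fac_uniq (zer_fac (fac_one h)) h. Qed.

Lemma zer_uni f : f 0 = 1 -> uni (fun n => th n == 0) (zer_part f).
Proof. by move/zer_fac=> [a [b []]]. Qed.

Lemma zer_supp P f : aclosed P -> uni P f -> uni P (zer_part f).
Proof. by move=> hP hf; have [a [b []]] := fac_supp hP hf. Qed.

Lemma zer_mul_gt u f : f 0 = 1 -> uni (fun n => 0 < th n) u ->
  zer_part (u * f) = zer_part f.
Proof.
move=> f0 hu; apply: zer_partE; have [a [b [ha hx hb e]]] := zer_fac f0.
exists (u * a), b; split=> //; first exact: uniM gt_closed hu ha.
by rewrite {1}e !mulrA.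
Qed.

Lemma zer_mul_lt u f : f 0 = 1 -> uni (fun n => th n < 0) u ->
  zer_part (f * u) = zer_part f.
Proof.
move=> f0 hu; apply: zer_partE; have [a [b [ha hx hb e]]] := zer_fac f0.
exists a, (b * u); split=> //; first exact: uniM lt_closed hb hu.
by rewrite {1}e !mulrA.
Qed.

Lemma uni_conj (p q : pred M) u a : aclosed p ->
  (forall n m, p n -> q m -> p (n + m)) -> (forall n m, q n -> q m -> q (n + m)) ->
  uni q u -> uni p a -> uni p (u * a * sinv u) /\ uni p (sinv u * a * u).
Proof.
move=> hp hpq hq hu ha; have u0 : u 0 = 1 by case: hu.
have a0 : a 0 = 1 by case: ha.
have hv := sinv_supp hq hu; have v0 := sinv0 u0.
have aux x y : uni q x -> uni q y -> x * y = 1 -> uni p (x * a * y).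
  move=> hx hy exy; have x0 : x 0 = 1 by case: hx.
  have y0 : y 0 = 1 by case: hy.
  split=> [|n n0]; first by rewrite !ser0M x0 a0 y0 !mulr1.
  have -> : x * a * y = 1 + x * (a - 1) * y.
    rewrite mulrBr mulr1 mulrBl exy.
    by apply: serP => m; rewrite !(serDE, serNE); ring.
  rewrite serDE ser1E (negPf n0) add0r.
  case/mul_neq0=> m [hm /mul_neq0[k [hk xk ak]] ym].
  have pk : p (m - k).
    case: (eqVneq (m - k) 0) ak => [->|h]; first by rewrite serBE a0 ser1E eqxx subrr eqxx.
    by rewrite serBE ser1E (negPf h) subr0; apply: (proj2 ha).
  have pm : p m.
    case: (eqVneq k 0) => [k0|k0]; first by rewrite k0 subr0 in pk.
    by rewrite -(subrK k m); apply: hpq => //; apply: (proj2 hx).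
  case: (eqVneq (n - m) 0) => [/eqP|h]; first by rewrite subr_eq0 => /eqP ->.
  by rewrite -(subrK m n) addrC; apply: hpq => //; apply: (proj2 hy).
by split; apply: aux => //; [apply: mulrsV | apply: mulVrs].
Qed.

(** The factor of f on th > 0 is conjugated past u; conjugation by a series on th = 0 keeps
    exponents on th > 0. *)
Lemma zer_mul_eql u f : f 0 = 1 -> uni (fun n => th n == 0) u ->
  zer_part (u * f) = u * zer_part f.
Proof.
move=> f0 hu; apply: zer_partE; have [a [b [ha hx hb e]]] := zer_fac f0.
have u0 : u 0 = 1 by case: hu.
exists (u * a * sinv u), b; split=> //.
- have [] // := @uni_conj (fun n => 0 < th n) (fun n => th n == 0) u a.
  + exact: gt_closed.
  + by move=> n m; rewrite hth; lia.
  + exact: eq_closed.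
- exact: uniM eq_closed hu hx.
- by rewrite {1}e !mulrA -(mulrA _ (sinv u) u) mulVrs // mulr1.
Qed.

Lemma zer_mul_eqr u f : f 0 = 1 -> uni (fun n => th n == 0) u ->
  zer_part (f * u) = zer_part f * u.
Proof.
move=> f0 hu; apply: zer_partE; have [a [b [ha hx hb e]]] := zer_fac f0.
have u0 : u 0 = 1 by case: hu.
exists a, (sinv u * b * u); split=> //.
- exact: uniM eq_closed hx hu.
- have [] // := @uni_conj (fun n => th n < 0) (fun n => th n == 0) u b.
  + exact: lt_closed.
  + by move=> n m; rewrite hth; lia.
  + exact: eq_closed.
- by rewrite {1}e !mulrA -(mulrA _ u (sinv u)) mulrsV // mulr1.
Qed.

End Theta.
End Factorisation.

(** * Skew forms and linear forms *)

Record skewform (M : zmodType) := Skewform {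
  sk :> M -> M -> int;
  skDl : forall a b c, sk (a + b) c = sk a c + sk b c;
  skC : forall a b, sk a b = - sk b a }.

Section Skewform.
Variables (M : zmodType) (w : skewform M).

Lemma skDr a b c : w a (b + c) = w a b + w a c.
Proof. by rewrite skC skDl opprD -!(skC w a). Qed.

Lemma sk_lin a : lin (w a). Proof. by move=> b c; apply: skDr. Qed.

Lemma skxx a : w a a = 0. Proof. by have := skC w a a; lia. Qed.

Variables (K : realFieldType) (q : K) (hq : q != 0).

Lemma qchiDl a b c : q ^ w (a + b) c = q ^ w a c * q ^ w b c.
Proof. by rewrite skDl expfzDr. Qed.
Lemma qchiDr a b c : q ^ w a (b + c) = q ^ w a b * q ^ w a c.
Proof. by rewrite skDr expfzDr. Qed.
Lemma qchi_neq0 a b : q ^ w a b != 0.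
Proof. exact: expfz_neq0. Qed.

Definition qchi : bichar M K := Bichar qchiDl qchiDr qchi_neq0.
End Skewform.

Section Lin.
Variables (M : zmodType) (th : M -> int) (hth : lin th).
Lemma lin0 : th 0 = 0.
Proof. by have := hth 0 0; rewrite addr0; lia. Qed.
Lemma linN n : th (- n) = - th n.
Proof. by have := hth n (- n); rewrite subrr lin0; lia. Qed.
Lemma linB n m : th (n - m) = th n - th m.
Proof. by rewrite hth linN. Qed.
Lemma linMn n k : th (n *+ k) = th n *+ k.
Proof. by elim: k => [|k IH]; rewrite ?mulr0n ?lin0 // !mulrS hth IH. Qed.
End Lin.

Lemma linMz (M : zmodType) (th : M -> int) n z : lin th -> th (n *~ z) = z * th n.
Proof.
move=> hth; case: z => a; first by rewrite -pmulrn (linMn hth) mulrC -mulr_natr natz.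
by rewrite NegzE mulrNz (linN hth) -pmulrn (linMn hth) -mulr_natl natz mulNr.
Qed.

(** * Logarithmic derivatives and change of completion *)

Section LogDerivative.
Variables (M : zmodType) (K : realFieldType) (q : K) (hq : q != 0).
Variables (w : skewform M) (S : cone M).
Notation chi := (qchi w hq).
Notation ser := (ser chi S).
Implicit Types (f g u v a b x y : ser) (n m : M) (d : nat) (p P : pred M)
  (la mu : M -> int).

Definition sD la f : ser := ser_res chi S (fun n => (la n)%:~R * f n).

Lemma sDE la f n : sD la f n = (la n)%:~R * f n.
Proof. by rewrite ser_resE; case: ifPn => // h; rewrite cf_supp // mulr0. Qed.

Lemma sD_mul la f g : lin la -> sD la (f * g) = sD la f * g + f * sD la g.
Proof.
move=> hl; apply: serP => n; rewrite sDE serDE !serME mulr_sumr -big_split /=.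
apply: eq_bigr => m _; rewrite !sDE.
have -> : la n = la m + la (n - m) by rewrite -hl addrC subrK.
by rewrite intrD; ring.
Qed.

Lemma sD1 la : lin la -> sD la 1 = 0.
Proof.
move=> hl; apply: serP => n; rewrite sDE ser1E ser0E.
by case: eqP => [->|]; rewrite ?lin0 // ?mul0r ?mulr0.
Qed.

Lemma sD_comm la mu f : sD la (sD mu f) = sD mu (sD la f).
Proof. by apply: serP => n; rewrite !sDE; ring. Qed.

Definition sup p f := forall n, f n != 0 -> p n.

Lemma supM p f g : aclosed p -> sup p f -> sup p g -> sup p (f * g).
Proof.
move=> hp hf hg n /mul_neq0[m [_ fm gm]].
by rewrite -(subrK m n); apply: hp; [apply: hg | apply: hf].
Qed.

Lemma uni_sup p f : p 0 -> uni p f -> sup p f.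
Proof. by move=> p0 [_ hf] n fn; case: (eqVneq n 0) => [->|n0] //; apply: hf. Qed.

Lemma sup_sD p la f : sup p f -> sup p (sD la f).
Proof.
by move=> hf n; rewrite sDE => h; apply: hf; apply: contraNneq h => ->; rewrite mulr0.
Qed.

Notation orth n := (fun m => w n m == 0).

Lemma orth_closed n : aclosed (orth n).
Proof. exact/eq_closed/sk_lin. Qed.

(** If [w n m = 0] then X^m commutes with X^(n - m), so each contributing pair gives the same term
    in either order. On series orthogonal to n the X^n-coefficient is thus a trace. *)
Lemma ser_trace f g n : sup (orth n) f -> (f * g) n = (g * f) n.
Proof.
move=> hf; rewrite !serME.
have c m : f m != 0 -> chi m (n - m) = 1 /\ chi (n - m) m = 1.
  move=> /hf /eqP e /=; rewrite (linB (sk_lin w m)) skDl e skxx.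
  by rewrite (skC w m n) e (skC w _ m) linN ?oppr0 ?skxx //; apply: sk_lin.
pose r := [seq n - m | m <- cdec S n].
have -> : \sum_(m <- cdec S n) g m * f (n - m) * chi m (n - m) =
   \sum_(m <- r) g m * f (n - m) * chi m (n - m).
  apply: perm_big; apply: uniq_perm; first exact: cdec_uniq.
    by rewrite map_inj_uniq ?cdec_uniq // => a b /addrI/oppr_inj.
  move=> m; rewrite mem_cdec; apply/andP/mapP => [[h1 h2]|[k hk ->]].
    by exists (n - m); rewrite ?subKr // mem_cdec subKr h2 h1.
  by move: hk; rewrite mem_cdec subKr => /andP[-> ->].
rewrite big_map; apply: eq_bigr => m _; rewrite subKr.
case: (eqVneq (f m) 0) => [->|/c [-> ->]]; first by rewrite mulr0 !mul0r.
by rewrite !mulr1 mulrC.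
Qed.

Lemma sinvM x y : x 0 = 1 -> y 0 = 1 -> sinv (x * y) = sinv y * sinv x.
Proof.
move=> x0 y0; symmetry; apply: sinv_uniq; first by rewrite ser0M x0 y0 mulr1.
by rewrite mulrA -(mulrA x) mulrsV // mulr1 mulrsV.
Qed.

(** For x supported orthogonally to n this is [la n] times the X^n-coefficient of log x; using the
    logarithmic derivative avoids summing the logarithm. *)
Definition logder la n x := (sinv x * sD la x) n.

Lemma logderM la n x y : lin la -> uni (orth n) x -> uni (orth n) y ->
  logder la n (x * y) = logder la n x + logder la n y.
Proof.
move=> hl hx hy; have x0 : x 0 = 1 by case: hx.
have y0 : y 0 = 1 by case: hy.
rewrite /logder sinvM // sD_mul // mulrDr serDE; congr (_ + _); last first.
  by rewrite mulrA -(mulrA (sinv y)) mulVrs // mulr1.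
rewrite -mulrA (@ser_trace (sinv y)).
  by rewrite mulrA -(mulrA _ y) mulrsV // mulr1.
apply: uni_sup; first by rewrite lin0 //; apply: sk_lin.
exact: sinv_supp (@orth_closed n) hy.
Qed.

(* The logarithmic derivatives A = x^-1 D_la x and B = x^-1 D_mu x satisfy
   D_la B - D_mu A = [B, A], and commutators have no X^n-coefficient by ser_trace. *)
Lemma logder_prop la mu n x : lin la -> lin mu -> uni (orth n) x ->
  (la n)%:~R * logder mu n x = (mu n)%:~R * logder la n x.
Proof.
move=> hl hm hx; have x0 : x 0 = 1 by case: hx.
have o0 : orth n 0 by rewrite lin0 //; apply: sk_lin.
have sx : sup (orth n) x by apply: uni_sup.
have sv : sup (orth n) (sinv x).
  by apply: uni_sup => //; apply: sinv_supp hx; apply: orth_closed.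
have Dv nu : lin nu -> sD nu (sinv x) = - (sinv x * sD nu x * sinv x).
  move=> hn; have : sD nu (x * sinv x) = 0 by rewrite mulrsV // sD1.
  rewrite sD_mul // => /eqP; rewrite addrC addr_eq0 => /eqP e.
  by rewrite -[LHS]mul1r -(mulVrs x0) -mulrA e mulrN mulrA.
have key nu nu' : lin nu -> lin nu' -> sD nu (sinv x * sD nu' x) =
   - (sinv x * sD nu x * (sinv x * sD nu' x)) + sinv x * sD nu (sD nu' x).
  by move=> h1 h2; rewrite sD_mul // Dv // mulNr !mulrA.
have := congr1 (fun f : ser => f n) (key la mu hl hm).
have := congr1 (fun f : ser => f n) (key mu la hm hl).
rewrite !sDE !serDE !serNE (sD_comm mu la).
rewrite (@ser_trace (sinv x * sD mu x)); last first.
  by apply: supM; [exact: orth_closed | | apply: sup_sD].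
by rewrite /logder; lra.
Qed.

Lemma logder_supp P la n x : aclosed P -> uni P x -> n != 0 -> ~~ P n ->
  logder la n x = 0.
Proof.
move=> hP hx n0 hn; apply/eqP; apply: contraNT hn => /mul_neq0[m [hm h1 h2]].
have [v0 hv] := sinv_supp hP hx; have [x0 hx'] := hx.
have h2' : x (n - m) != 0 by apply: contraNneq h2; rewrite sDE => ->; rewrite mulr0.
case: (eqVneq m 0) => [m0|m0].
  by rewrite m0 subr0 in h2'; apply: hx'.
case: (eqVneq (n - m) 0) => [/eqP|e].
  by rewrite subr_eq0 => /eqP ->; apply: hv.
by rewrite -(subrK m n); apply: hP; [apply: hx' | apply: hv].
Qed.

Lemma lowMl d f g : low d f -> low d (f * g).
Proof. by move=> h n hn; rewrite (mul_lowl _ h) ?(ltnW hn) // h // mul0r. Qed.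
Lemma lowMr d f g : low d f -> low d (g * f).
Proof. by move=> h n hn; rewrite (mul_lowr _ h) ?(ltnW hn) // h // mulr0. Qed.

Lemma spl_top d p f g : low d (f - g) ->
  low d (spl p f - spl p g) /\
  forall n, (cdeg S n <= d)%N -> spl p f n - spl p g n = f n - g n.
Proof.
move=> h.
have step j : (j <= d)%N -> low j (spl p f - spl p g) ->
    forall n, (cdeg S n <= j)%N -> spl p f n - spl p g n = f n - g n.
  move=> jd hj n hn; rewrite -[LHS]serBE (splE p f) (splE p g).
  set s := proj p (spl p f) * _; set t := proj p (spl p g) * _.
  have -> : f - 1 - s - (g - 1 - t) = (f - g) - (s - t).
    by apply: serP => m; rewrite !(serDE, serNE); ring.
  rewrite serBE (mulB_top (proj_low _ hj) (proj_low _ hj)) // !proj0.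
  by rewrite mul0r mulr0 addr0 subr0 serBE.
have hlow j : (j <= d)%N -> low j (spl p f - spl p g).
  elim: j => [|j IH] jd; first exact: low0.
  move=> n hn; rewrite serBE (step j) //; [|exact: ltnW|exact/IH/ltnW].
  by rewrite -serBE h //; apply: leq_trans jd.
by split; [exact: hlow | apply: step (hlow _ _)].
Qed.

Lemma lft_top d p f g : low d (f - g) -> low d (lft p f - lft p g) /\
  forall n, (cdeg S n <= d)%N -> n != 0 -> p n ->
    lft p f n - lft p g n = f n - g n.
Proof.
move=> h; have [h1 h2] := spl_top p h; split.
  rewrite /lft; have -> u v : (1 + u : ser) - (1 + v) = u - v.
    by apply: serP => m; rewrite !(serDE, serNE); ring.
  exact: proj_low.
move=> n hn n0 pn; rewrite !serDE !projE n0 pn /= -(h2 n) //; ring.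
Qed.

Lemma rgt_top d p f g : low d (f - g) -> low d (rgt p f - rgt p g) /\
  forall n, (cdeg S n <= d)%N -> n != 0 -> ~~ p n ->
    rgt p f n - rgt p g n = f n - g n.
Proof.
move=> h; have [h1 h2] := spl_top p h; split.
  rewrite /rgt; have -> u v : (1 + u : ser) - (1 + v) = u - v.
    by apply: serP => m; rewrite !(serDE, serNE); ring.
  exact: proj_low.
move=> n hn n0 pn; rewrite !serDE !projE n0 /= pn -(h2 n) //; ring.
Qed.

Lemma zer_top d th f g : low d (f - g) -> 
  low d (zer_part th f - zer_part th g) /\
  forall n, (cdeg S n <= d)%N -> n != 0 -> th n = 0 ->
    zer_part th f n - zer_part th g n = f n - g n.
Proof.
move=> h; have [h1 h2] := rgt_top (fun n => 0 < th n) h.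
have [h3 h4] := lft_top (fun n => 0 <= th n) h1; split=> // n hn n0 tn.
by rewrite h4 ?tn // h2 // tn.
Qed.

Lemma sD_low la d f : low d f -> low d (sD la f).
Proof. by move=> h n hn; rewrite sDE h // mulr0. Qed.

(** To leading order, factorising and taking the logarithmic derivative only multiply the
    coefficient at n by [la n]. If [la n] is nonzero, prescribing [logder] at n determines that
    coefficient from those of lower degree. *)
Lemma logder_top d la th f g n : lin th -> lin la -> f 0 = 1 -> g 0 = 1 ->
  low d (f - g) -> (cdeg S n <= d)%N -> n != 0 -> th n = 0 ->
  logder la n (zer_part th f) - logder la n (zer_part th g) = (la n)%:~R * (f n - g n).
Proof.
move=> ht hl f0 g0 h hn n0 tn; have [h1 h2] := zer_top th h.
rewrite -(h2 n) //; set x := zer_part th f in h1 *; set y := zer_part th g in h1 *.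
have x0 : x 0 = 1 by case: (zer_uni ht f0).
have y0 : y 0 = 1 by case: (zer_uni ht g0).
clearbody x y.
have hv : low d (sinv x - sinv y).
  have -> : sinv x - sinv y = - (sinv x * (x - y) * sinv y).
    by rewrite mulrBr mulrBl mulVrs // mul1r -mulrA mulrsV // mulr1 opprB.
  by move=> m hm; rewrite serNE (lowMl _ (lowMr _ h1)) // oppr0.
have hD : low d (sD la x - sD la y).
  have -> : sD la x - sD la y = sD la (x - y).
    by apply: serP => m; rewrite serBE !sDE serBE; ring.
  exact: sD_low.
rewrite /logder -serBE (mulB_top hv hD) // sinv0 // !sDE (lin0 hl) !mul0r mulr0.
by ring.
Qed.

End LogDerivative.

(** * Comparing series in two completions *)

Section Transport.
Variables (M : zmodType) (K : realFieldType) (q : K) (hq : q != 0).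
Variables (w : skewform M) (S S' : cone M).
Notation chi := (qchi w hq).
Variables (tau tau' : M -> M).
Hypotheses (tauD : forall a b, tau (a + b) = tau a + tau b)
  (tauK : cancel tau tau') (tauK' : cancel tau' tau)
  (tauw : forall a b, w (tau a) (tau b) = w a b).
Implicit Types (f g x y : ser chi S).

(* f and f' are the same series up to the substitution tau of the exponents,
   although they live in different completions. *)
Definition trel f (f' : ser chi S') := forall n, f (tau n) = f' n.

Lemma tau0 : tau 0 = 0.
Proof. by apply: (addrI (tau 0)); rewrite -tauD !addr0. Qed.
Lemma tauN n : tau (- n) = - tau n.
Proof. by apply: (addrI (tau n)); rewrite -tauD !subrr tau0. Qed.
Lemma tauB n m : tau (n - m) = tau n - tau m.
Proof. by rewrite tauD tauN. Qed.
Lemma tau'D a b : tau' (a + b) = tau' a + tau' b.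
Proof. by apply: (can_inj tauK); rewrite tauD !tauK'. Qed.

Lemma rel_mul f (f' : ser chi S') g (g' : ser chi S') : trel f f' -> trel g g' -> trel (f * g) (f' * g').
Proof.
move=> hf hg n; rewrite !serME.
(* The two products run over splittings in different cones. A nonzero term splits n in both, so both
   sums are cut down to the common splittings. *)
pose Q m := cmem S (tau m) && cmem S (tau (n - m)).
pose Q' m := cmem S' (tau' m) && cmem S' (tau' (tau n - m)).
have -> : \sum_(m <- cdec S' n) f' m * g' (n - m) * chi m (n - m) =
  \sum_(m <- [seq m <- cdec S' n | Q m]) f' m * g' (n - m) * chi m (n - m).
  rewrite big_filter [RHS]big_mkcond; apply: eq_bigr => m _.
  case: ifPn => //; rewrite negb_and -hf -hg => /orP[]/(cf_supp _) ->.
    by rewrite !mul0r.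
  by rewrite mulr0 mul0r.
have -> : \sum_(m <- cdec S (tau n)) f m * g (tau n - m) * chi m (tau n - m) =
  \sum_(m <- [seq m <- cdec S (tau n) | Q' m]) f m * g (tau n - m) * chi m (tau n - m).
  rewrite big_filter [RHS]big_mkcond; apply: eq_bigr => m _.
  have e1 : f m = f' (tau' m) by rewrite -hf tauK'.
  have e2 : g (tau n - m) = g' (tau' (tau n - m)) by rewrite -hg tauK'.
  case: ifPn => //; rewrite negb_and e1 e2 => /orP[]/(cf_supp _) ->.
    by rewrite !mul0r.
  by rewrite mulr0 mul0r.
transitivity (\sum_(m <- [seq tau m | m <- [seq m <- cdec S' n | Q m]])
   f m * g (tau n - m) * chi m (tau n - m)).
  apply: perm_big; apply: uniq_perm.
  - by rewrite filter_uniq // cdec_uniq.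
  - rewrite map_inj_uniq ?filter_uniq ?cdec_uniq //; exact: can_inj tauK.
  move=> m; rewrite -[m]tauK' mem_map; last exact: can_inj tauK.
  rewrite !mem_filter !mem_cdec /Q /Q' -!tauB !tauK.
  by rewrite andbC.
rewrite big_map; apply: eq_bigr => m _.
by rewrite -tauB hf hg /= tauw.
Qed.

Lemma rel1 : trel 1 1.
Proof. by move=> n; rewrite !ser1E -{1}tau0 (inj_eq (can_inj tauK)). Qed.

Definition interP : pred M := fun m => cmem S m && cmem S' (tau' m).

Lemma interP_closed : aclosed interP.
Proof.
move=> n m /andP[h1 h2] /andP[h3 h4]; apply/andP; split; first exact: cmemD.
by rewrite tau'D cmemD.
Qed.

Lemma rel_interP f (f' : ser chi S') : f 0 = 1 -> trel f f' -> uni interP f.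
Proof.
move=> f0 h; split=> // n _ hn; rewrite /interP (cf_mem hn).
by apply: (@cf_mem _ _ _ _ f'); rewrite -h tauK'.
Qed.

Lemma rel_ex f : uni interP f -> exists f' : ser chi S', trel f f'.
Proof.
move=> [f0 hf]; exists (ser_res chi S' (fun n => f (tau n))) => n.
rewrite ser_resE; case: ifPn => // hn; apply/eqP; apply: contraNT hn => h.
case: (eqVneq n 0) => [->|n0]; first exact: cmem0.
by have := hf _ _ h; rewrite /interP tauK => /(_ _)/andP[]//;
  rewrite -tau0 (inj_eq (can_inj tauK)).
Qed.

Lemma rel_fun f (f' g' : ser chi S') : trel f f' -> trel f g' -> f' = g'.
Proof. by move=> h1 h2; apply: serP => n; rewrite -h1 -h2. Qed.

Lemma rel0 f (f' : ser chi S') : trel f f' -> f 0 = 1 -> f' 0 = 1.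
Proof. by move=> h; rewrite -h tau0. Qed.

Lemma rel_sinv x (x' : ser chi S') : x 0 = 1 -> trel x x' -> trel (sinv x) (sinv x').
Proof.
move=> x0 h; have hx := rel_interP x0 h.
have [y hy] := rel_ex (sinv_supp interP_closed hx).
suff <- : y = sinv x' by [].
apply: sinv_uniq; first exact: rel0 h x0.
by apply: (rel_fun (rel_mul h hy)); rewrite mulrsV //; apply: rel1.
Qed.

Lemma rel_sD la f (f' : ser chi S') : trel f f' -> trel (sD la f) (sD (la \o tau) f').
Proof. by move=> h n; rewrite !sDE h. Qed.

Lemma rel_logder la x (x' : ser chi S') n : x 0 = 1 -> trel x x' ->
  logder la (tau n) x = logder (la \o tau) n x'.
Proof. by move=> x0 h; apply: rel_mul; [exact: rel_sinv | exact: rel_sD]. Qed.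

Lemma rel_uni p f (f' : ser chi S') : trel f f' -> uni p f -> uni (p \o tau) f'.
Proof.
move=> h [f0 hf]; split=> [|n n0]; first exact: rel0 h f0.
rewrite -h; apply: hf; by rewrite -tau0 (inj_eq (can_inj tauK)).
Qed.

(** A series present in both completions is supported in the intersection of the cones. By
    [fac_supp] its three factors stay there and have counterparts on the other side; uniqueness of
    the factorisation identifies them. *)
Lemma rel_zer th f (f' : ser chi S') : lin th -> f 0 = 1 -> trel f f' ->
  trel (zer_part th f) (zer_part (th \o tau) f').
Proof.
move=> ht f0 h; have hf := rel_interP f0 h.
have [a [b [[ha hx hb e] Pa Px Pb]]] := fac_supp ht interP_closed hf.
have [a' ha'] := rel_ex Pa; have [b' mut_compat] := rel_ex Pb; have [x' hx'] := rel_ex Px.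
suff -> : zer_part (th \o tau) f' = x' by [].
apply: zer_partE; first by move=> n m /=; rewrite tauD ht.
exists a', b'; split.
- exact: rel_uni ha' ha.
- exact: rel_uni hx' hx.
- exact: rel_uni mut_compat hb.
- by apply: (rel_fun h); rewrite e; apply: rel_mul (rel_mul ha' hx') mut_compat.
Qed.

End Transport.

(** * Finite sums and cones spanned by a basis *)

Lemma sum_seq_supp (T : eqType) (K : realFieldType) (r1 r2 : seq T) (F : T -> K) :
  uniq r1 -> uniq r2 ->
  (forall m, m \in r1 -> F m != 0 -> m \in r2) ->
  (forall m, m \in r2 -> F m != 0 -> m \in r1) ->
  \sum_(m <- r1) F m = \sum_(m <- r2) F m.
Proof.
move=> u1 u2 h1 h2.
have aux (r : seq T) : \sum_(m <- r) F m = \sum_(m <- [seq m <- r | F m != 0]) F m.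
  rewrite big_filter [RHS]big_mkcond; apply: eq_bigr => m _.
  by case: eqP.
rewrite (aux r1) (aux r2); apply: perm_big; apply: uniq_perm; rewrite ?filter_uniq //.
move=> m; rewrite !mem_filter; case: (eqVneq (F m) 0) => //= h.
by apply/idP/idP => hm; [apply: h1 | apply: h2].
Qed.

Lemma sum_antidiag (K : realFieldType) N (G : nat -> nat -> K) (U : nat -> K) :
  (forall t, (N <= t)%N -> U t = 0) ->
  \sum_(c < N) \sum_(j < N) G c j * U (c + j)%N =
  \sum_(t < N) (\sum_(c < t.+1) G c (t - c)%N) * U t.
Proof.
move=> hU.
transitivity (\sum_(c < N) \sum_(t < N) if (c <= t)%N then G c (t - c)%N * U t else 0).
  apply: eq_bigr => c _; rewrite -[RHS]big_mkcond /=.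
  rewrite -(big_mkord (fun t => (c <= t)%N) (fun t => G c (t - c)%N * U t)).
  rewrite (big_cat_nat (n := c)) ?leq0n //=; last by apply: ltnW.
  rewrite [X in _ = X + _]big_nat_cond [X in _ = X + _]big1 ?add0r; last first.
    by move=> t ht; exfalso; lia.
  rewrite [RHS]big_nat_cond [RHS](eq_bigl (fun t => (c <= t < N)%N)); last by move=> t; lia.
  rewrite -[RHS]big_nat.
  have -> : \sum_(c <= t < N) G c (t - c)%N * U t =
    \sum_(0 + c <= t < N) G c (t - c)%N * U t by [].
  rewrite big_addn.
  rewrite -(big_mkord xpredT (fun j => G c j * U (c + j)%N)).
  rewrite (big_cat_nat (n := (N - c)%N)) ?leq0n ?leq_subr //=.
  rewrite [X in _ + X]big_nat_cond [X in _ + X]big1 ?addr0; last first.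
    by move=> j hj; rewrite hU ?mulr0 //; lia.
  by apply: eq_bigr => j _; rewrite addnK addnC.
rewrite exchange_big; apply: eq_bigr => t _ /=; rewrite mulr_suml -big_mkcond /=.
rewrite -(big_mkord (fun c => (c <= t)%N) (fun c => G c (t - c)%N * U t)).
rewrite -(big_mkord xpredT (fun c => G c (t - c)%N * U t)).
rewrite (big_cat_nat (n := t.+1)) ?leq0n //=; rewrite [X in _ + X]big_nat_cond [X in _ + X]big1.
  by rewrite addr0 big_nat_cond [RHS]big_nat_cond; apply: eq_bigl => c; lia.
by move=> c hc; exfalso; lia.
Qed.

Record basis (M : zmodType) (I : finType) := Basis {
  bv : I -> M;
  bx : I -> M -> int;
  bxD : forall i, lin (bx i);
  bxv : forall i j, bx i (bv j) = (i == j)%:Z;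
  bsum : forall n, n = \sum_i bv i *~ bx i n }.

Section BasisCone.
Variables (M : zmodType) (I : finType) (E : basis M I).

Lemma bx_inj n m : (forall i, bx E i n = bx E i m) -> n = m.
Proof. by move=> h; rewrite (bsum E n) (bsum E m); apply: eq_bigr => i _; rewrite h. Qed.

Definition bmem n := [forall i, 0 <= bx E i n].
Lemma bmemP n : reflect (forall i, 0 <= bx E i n) (bmem n).
Proof. exact: forallP. Qed.
Definition bdeg n := (\sum_i absz (bx E i n))%N.
Definition bcomb (N : nat) (f : {ffun I -> 'I_N}) : M := \sum_i bv E i *+ (f i).
(** A summand of n inside the cone has coordinates bounded by those of n, hence by [bdeg n], so
    these finitely many combinations exhaust all splittings. *)
Definition bdec n := [seq m <- undup [seq bcomb f | f : {ffun I -> 'I_(bdeg n).+1}] |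
   bmem m && bmem (n - m)].

Lemma bdec_uniq n : uniq (bdec n).
Proof. by rewrite filter_uniq ?undup_uniq. Qed.

Lemma bx_bdeg i n : (`|bx E i n| <= bdeg n)%N.
Proof. by rewrite /bdeg (bigD1 i) //= leq_addr. Qed.

Lemma mem_bdec m n : (m \in bdec n) = bmem m && bmem (n - m).
Proof.
rewrite mem_filter mem_undup; case: (boolP (bmem m && bmem (n - m))) => //=.
case/andP=> /bmemP h1 /bmemP h2; apply/mapP.
exists [ffun i => inord `|bx E i m|]; first by rewrite mem_enum.
rewrite [LHS](bsum E) /bcomb; apply: eq_bigr => i _; rewrite ffunE inordK.
  by rewrite pmulrn gez0_abs.
have := bx_bdeg i n; have := h1 i; have := h2 i; rewrite (linB (bxD E i)).
by lia.
Qed.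

Lemma bmem0 : bmem 0.
Proof. by apply/bmemP => i; rewrite lin0 //; apply: bxD. Qed.
Lemma bmemD a b : bmem a -> bmem b -> bmem (a + b).
Proof.
move=> /bmemP h1 /bmemP h2; apply/bmemP => i; rewrite bxD.
by have := h1 i; have := h2 i; lia.
Qed.
Lemma bdegD a b : bmem a -> bmem b -> bdeg (a + b) = (bdeg a + bdeg b)%N.
Proof.
move=> /bmemP h1 /bmemP h2; rewrite /bdeg -big_split /=; apply: eq_bigr => i _.
by rewrite bxD; have := h1 i; have := h2 i; lia.
Qed.
Lemma bdeg_eq0 a : bmem a -> bdeg a = 0%N -> a = 0.
Proof.
move=> _ h; apply: bx_inj => i; rewrite (lin0 (bxD E i)).
by have := bx_bdeg i a; rewrite h; lia.
Qed.

Definition bcone : cone M :=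
  Cone bdec_uniq mem_bdec bmem0 bmemD bdegD bdeg_eq0.

Lemma bxMn i j a : bx E i (bv E j *+ a) = if i == j then a%:Z else 0.
Proof.
rewrite (linMn (bxD E i)) bxv; case: eqP => _; rewrite ?mul0rn //.
by rewrite -[LHS]mulr_natr mul1r natz.
Qed.

Lemma bmem_bvMn i a : bmem (bv E i *+ a).
Proof. by apply/bmemP => j; rewrite bxMn; case: eqP. Qed.

Lemma bv_neq0 i : bv E i != 0.
Proof.
by apply/eqP => h; have := bxv E i i; rewrite h (lin0 (bxD E i)) eqxx.
Qed.

Lemma bvMn_eq0 i a : (bv E i *+ a == 0) = (a == 0%N).
Proof.
apply/eqP/eqP => [h|->]; last by rewrite mulr0n.
by have := bxMn i i a; rewrite h (lin0 (bxD E i)) eqxx => -[].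
Qed.

Lemma bmem_bx_lt0 n i : bx E i n < 0 -> ~~ bmem n.
Proof. by move=> h; apply/bmemP => /(_ i); lia. Qed.

Lemma lin_bsum th n : lin th -> th n = \sum_i bx E i n * th (bv E i).
Proof.
move=> hth.
have ths (r : seq I) : th (\sum_(i <- r) bv E i *~ bx E i n) =
   \sum_(i <- r) bx E i n * th (bv E i).
  elim: r => [|i r IH]; first by rewrite !big_nil lin0.
  by rewrite !big_cons hth IH (linMz _ _ hth).
by rewrite {1}(bsum E n) ths.
Qed.

End BasisCone.

(** * The q-exponential *)

Section QExp.
Variables (K : realFieldType) (v : K).
Hypotheses (v0 : 0 < v) (v1 : v < 1).

(* psi(x) = sum_a psi a x^a is the q-exponential with psi(v^2 x) = (1 + v x) psi(x);
   pc s lists the coefficients of psi(v^(2s) x) / psi(x). *)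
Fixpoint psi (a : nat) : K :=
  if a is a'.+1 then v * psi a' / (v ^+ (2 * a) - 1) else 1.

Lemma vX_neq1 a : (0 < a)%N -> v ^+ a - 1 != 0.
Proof.
move=> ha; rewrite subr_eq0 neq_lt; apply/orP; left.
by rewrite exprn_ilt1 ?ltW // -lt0n.
Qed.

Fixpoint pc (s j : nat) : K :=
  match s, j with
  | 0, 0 => 1
  | 0, _ => 0
  | s'.+1, 0 => pc s' 0
  | s'.+1, j'.+1 => pc s' j'.+1 + v ^+ (2 * s' + 1) * pc s' j'
  end.

Lemma pcS s j : pc s.+1 j.+1 = pc s j.+1 + v ^+ (2 * s + 1) * pc s j.
Proof. by []. Qed.

Lemma psiS a : psi a.+1 * (v ^+ (2 * a.+1) - 1) = v * psi a.
Proof. by rewrite [psi a.+1]/= divfK // vX_neq1. Qed.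

Lemma pc0 s : pc s 0 = 1. Proof. by elim: s. Qed.

Lemma pc_gt s j : (s < j)%N -> pc s j = 0.
Proof.
elim: s j => [|s IH] [|j] //= h.
by rewrite !IH ?mulr0 ?addr0 //; lia.
Qed.

Arguments psi : simpl never.
Arguments pc : simpl never.

Lemma pc_psi s t :
  \sum_(c < t.+1) pc s (t - c) * psi c = v ^+ (2 * s * t) * psi t.
Proof.
elim: s t => [|s IH] t.
  rewrite muln0 mul0n expr0 mul1r big_ord_recr /= subnn mul1r big1 ?add0r // => c _.
  by rewrite -(subnSK (ltn_ord c)) mul0r.
case: t => [|t]; first by rewrite big_ord1 subn0 pc0 mul1r muln0 expr0 mul1r.
have := IH t.+1; rewrite [in X in _ -> X]big_ord_recr [in X in X -> _]big_ord_recr /=.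
rewrite !subnn !pc0 !mul1r.
have -> : \sum_(i < t.+1) pc s.+1 (t.+1 - i) * psi i =
  \sum_(i < t.+1) pc s (t.+1 - i) * psi i + v ^+ (2 * s + 1) * \sum_(i < t.+1) pc s (t - i) * psi i.
  rewrite mulr_sumr -big_split /=; apply: eq_bigr => i _.
  have hi : (i <= t)%N by rewrite -ltnS.
  by rewrite (subSn hi) pcS mulrDl mulrA.
rewrite IH => e.
have h := psiS t.
have -> : v ^+ (2 * s.+1 * t.+1) = v ^+ (2 * s * t.+1) * v ^+ (2 * t.+1).
  by rewrite -exprD; congr (_ ^+ _); lia.
have hs : v ^+ (2 * s + 1) * (v ^+ (2 * s * t) * psi t) = v ^+ (2 * s * t.+1) * (v * psi t).
  have -> : (2 * s * t.+1 = 2 * s * t + 2 * s)%N by lia.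
  by rewrite !exprD expr1; ring.
rewrite hs -h.
move: e; set X := \sum_(i < _) _; set Y := v ^+ _; set Z := v ^+ _; move: (psi _) => P e.
by rewrite -[X](addrK P) e; ring.
Qed.

(** This recursion splits off the first factor 1 + v x of the product instead of the last:
    pc_(s+1)(x) = (1 + v x) pc_s(v^2 x). *)
Lemma pcS2 s j : pc s.+1 j.+1 = v ^+ (2 * j.+1) * pc s j.+1 + v ^+ (2 * j + 1) * pc s j.
Proof.
elim: s j => [|s IH] j.
  rewrite pcS; have -> : pc 0 j.+1 = 0 by [].
  by case: j => [|j]; rewrite ?pc0 ?mulr0 // [pc 0 _]/pc !mulr0.
rewrite pcS; case: j => [|j].
  rewrite {1}IH [pc s.+1 1]pcS !pc0 !mulr1.
  have -> : (2 * s.+1 + 1 = 2 * s + 3)%N by lia.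
  rewrite !exprD; ring.
rewrite {1}(IH j.+1) {1}(IH j) [pc s.+1 j.+2]pcS [pc s.+1 j.+1]pcS.
have -> : (2 * s.+1 + 1 = 2 * s + 3)%N by lia.
have -> : (2 * j.+2 = 2 * j + 4)%N by lia.
have -> : (2 * j.+1 + 1 = 2 * j + 3)%N by lia.
have -> : (2 * j.+1 = 2 * j + 2)%N by lia.
rewrite !exprD; ring.
Qed.

(* coefficients of prod_(j < s) (1 + v^(2j+1-s) x), the palindromic normalisation of pc *)
Definition bq s j : K := pc s j / v ^+ (s * j).

Lemma bq0 s : bq s 0 = 1.
Proof. by rewrite /bq pc0 muln0 expr0 divr1. Qed.

Lemma bq_gt s j : (s < j)%N -> bq s j = 0.
Proof. by move=> h; rewrite /bq pc_gt // mul0r. Qed.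

Lemma vX_neq0 a : v ^+ a != 0.
Proof. by rewrite expf_neq0 // gt_eqF. Qed.

Lemma pc_top s : pc s s = v ^+ (s * s).
Proof.
elim: s => [|s IH] //; rewrite pcS pc_gt // add0r IH -exprD; congr (_ ^+ _); lia.
Qed.

(** Expanding one side by [pcS] and the other by [pcS2] makes the two induction hypotheses match
    crosswise. The symmetry is what lets a hop along e_k be read as a hop along -e_k after
    mutation. *)
Lemma pc_pal s i j : (i + j = s)%N -> pc s i * v ^+ (s * j) = pc s j * v ^+ (s * i).
Proof.
elim: s i j => [|s IH] [|i] [|j] // e.
- have -> : s = j by lia.
  by rewrite pc0 pc_top muln0 expr0 mul1r mulr1.
- have -> : s = i by lia.
  by rewrite pc0 pc_top muln0 expr0 mul1r mulr1.
rewrite pcS pcS2.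
have e1 := IH i.+1 j; have e2 := IH i j.+1.
have {}e1 := e1 ltac:(lia); have {}e2 := e2 ltac:(lia).
have -> : (s.+1 * j.+1 = s * j + s + j.+1)%N by lia.
have -> : (s.+1 * i.+1 = s * i + s + i.+1)%N by lia.
have e1' : pc s i.+1 * v ^+ (s * j) = pc s j * v ^+ (s * i) * v ^+ s.
  by rewrite e1 -mulrA -exprD; congr (_ * _ ^+ _); lia.
have e2' : pc s j.+1 * v ^+ (s * i) = pc s i * v ^+ (s * j) * v ^+ s.
  by rewrite -e2 -mulrA -exprD; congr (_ * _ ^+ _); lia.
rewrite mulrDl mulrDl addrC; congr (_ + _).
  transitivity (v ^+ (2 * s + 1 + s + j.+1) * (pc s i * v ^+ (s * j))).
    by rewrite !exprD; ring.
  transitivity (v ^+ (2 * j.+1 + s + i.+1) * (pc s j.+1 * v ^+ (s * i))); last first.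
    by rewrite !exprD; ring.
  rewrite e2'.
  transitivity (v ^+ (2 * j.+1 + s + i.+1 + s) * (pc s i * v ^+ (s * j))); last first.
    by rewrite !exprD; ring.
  by congr (_ ^+ _ * _); lia.
transitivity (v ^+ (s + j.+1) * (pc s i.+1 * v ^+ (s * j))).
  by rewrite !exprD; ring.
rewrite e1'.
transitivity (v ^+ (s + j.+1 + s) * (pc s j * v ^+ (s * i))).
  by rewrite !exprD; ring.
transitivity (v ^+ (2 * j + 1 + s + i.+1) * (pc s j * v ^+ (s * i))).
  by congr (_ ^+ _ * _); lia.
by rewrite !exprD; ring.
Qed.

Lemma bq_pal s j : (j <= s)%N -> bq s (s - j) = bq s j.
Proof.
move=> h; rewrite /bq; apply/eqP; rewrite eqr_div ?vX_neq0 //; apply/eqP.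
apply: pc_pal; lia.
Qed.

Lemma bq_psi s t :
  \sum_(c < t.+1) bq s (t - c) * psi c / v ^+ (s * c) = v ^+ (s * t) * psi t.
Proof.
transitivity (\sum_(c < t.+1) pc s (t - c) * psi c / v ^+ (s * t)).
  apply: eq_bigr => c _; rewrite /bq -mulrA mulrAC -mulrA.
  have -> : v ^+ (s * t) = v ^+ (s * (t - c)) * v ^+ (s * c).
    by rewrite -exprD -mulnDr subnK // -ltnS.
  by rewrite invfM; ring.
rewrite -mulr_suml pc_psi mulrAC; congr (_ * _).
have -> : (2 * s * t = s * t + s * t)%N by lia.
by rewrite exprD mulfK ?vX_neq0.
Qed.

End QExp.

Lemma sum_ord_ext (K : realFieldType) (F : nat -> K) A B :
  (forall j, (A <= j)%N -> F j = 0) -> (forall j, (B <= j)%N -> F j = 0) ->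
  \sum_(j < A) F j = \sum_(j < B) F j.
Proof.
have aux C D : (C <= D)%N -> (forall j, (C <= j)%N -> F j = 0) ->
   \sum_(j < C) F j = \sum_(j < D) F j.
  move=> h hF; rewrite -!(big_mkord xpredT) (@big_cat_nat _ _ _ C 0 D) //=.
  by rewrite [X in _ + X]big_nat_cond [X in _ + X]big1 ?addr0 // => j /andP[/andP[/hF]].
move=> hA hB; case: (leqP A B) => h; first exact: aux.
by rewrite (aux B A) // ltnW.
Qed.

(** * The series attached to a basis *)

Section Cluster.
Variables (M : zmodType) (I : finType) (w : skewform M) (E : basis M I).
Variables (delta : I -> nat) (b : I -> I -> int).
Hypothesis hd : forall i, (0 < delta i)%N.
Hypothesis hb : forall i j, w (bv E i) (bv E j) = - ((delta i)%:Z * b i j).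
Implicit Types (n m : M).

(** This is [w n (bv E k)] divided by [delta k]. Its absolute value is the number of factors that
    conjugation by the dilogarithm of e_k puts on X^n. *)
Definition slope k n : int := \sum_i bx E i n * b k i.

Lemma compatC i j : (delta i)%:Z * b i j = - ((delta j)%:Z * b j i).
Proof. by have e := skC w (bv E i) (bv E j); rewrite !hb in e; apply: oppr_inj. Qed.

Lemma slope_lin k : lin (slope k).
Proof.
move=> n m; rewrite /slope -big_split /=; apply: eq_bigr => i _.
by rewrite bxD mulrDl.
Qed.

Lemma w_bv k n : w n (bv E k) = (delta k)%:Z * slope k n.
Proof.
have hl : lin (fun n => w n (bv E k)) by move=> x y; rewrite skDl.
rewrite (lin_bsum E n hl) mulr_sumr; apply: eq_bigr => i _.
by rewrite hb compatC opprK; ring.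
Qed.

Lemma w_bvl k n : w (bv E k) n = - ((delta k)%:Z * slope k n).
Proof. by rewrite skC w_bv. Qed.

Lemma slope_bv k i : slope k (bv E i) = b k i.
Proof.
rewrite /slope (bigD1 i) //= bxv eqxx mul1r big1 ?addr0 // => j /negPf h.
by rewrite bxv h mul0r.
Qed.

Lemma slope_bvk k : slope k (bv E k) = 0.
Proof.
have := w_bv k (bv E k); rewrite skxx => /esym/eqP; rewrite mulf_eq0.
by case/orP=> /eqP // h; have := hd k; lia.
Qed.

Lemma slope_sub k n c : slope k (n - bv E k *+ c) = slope k n.
Proof. by rewrite (linB (slope_lin k)) (linMn (slope_lin k)) slope_bvk mul0rn subr0. Qed.

Lemma bx_sub k n c : bx E k (n - bv E k *+ c) = bx E k n - c%:Z.
Proof. by rewrite (linB (bxD E k)) bxMn eqxx. Qed.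

Lemma absbxMn k a : `|bx E k (bv E k *+ a)|%N = a.
Proof. by rewrite bxMn eqxx. Qed.

Lemma bvMn_inj k : injective (fun c => bv E k *+ c).
Proof. by move=> c d /(congr1 (bx E k)); rewrite !bxMn eqxx => -[]. Qed.

Lemma sub_mem k n c : bmem E (n - bv E k *+ c) -> bmem E n.
Proof. by move=> h; rewrite -(subrK (bv E k *+ c) n) bmemD // bmem_bvMn. Qed.

Definition neg_bound k n : int := \sum_i pospart (- b k i) * bx E i n.
Definition pos_bound k n : int := \sum_i pospart (b k i) * bx E i n.

Lemma sum_bx_lin (c : I -> int) : lin (fun n => \sum_i c i * bx E i n).
Proof.
move=> n m; rewrite -big_split /=; apply: eq_bigr => i _.
by rewrite bxD mulrDr.
Qed.

Lemma sum_bx_bv (c : I -> int) j : \sum_i c i * bx E i (bv E j) = c j.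
Proof.
rewrite (bigD1 j) //= bxv eqxx mulr1 big1 ?addr0 // => i /negPf h.
by rewrite bxv h mulr0.
Qed.

Lemma pospartE a : pospart a = pospart (- a) + a.
Proof. by rewrite /pospart; case: (lerP 0 a) => h1; case: (lerP 0 (- a)) => h2; lia. Qed.

Lemma pos_boundE k n : pos_bound k n = neg_bound k n + slope k n.
Proof.
rewrite -big_split /=; apply: eq_bigr => i _.
by rewrite [pospart (b k i)]pospartE mulrDl [b k i * _]mulrC.
Qed.

Lemma b_diag k : b k k = 0.
Proof. by rewrite -slope_bv slope_bvk. Qed.

Lemma neg_bound_lin k : lin (neg_bound k). Proof. exact: sum_bx_lin. Qed.
Lemma pos_bound_lin k : lin (pos_bound k). Proof. exact: sum_bx_lin. Qed.
Lemma neg_bound_bv k i : neg_bound k (bv E i) = pospart (- b k i). Proof. exact: sum_bx_bv. Qed.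
Lemma pos_bound_bv k i : pos_bound k (bv E i) = pospart (b k i). Proof. exact: sum_bx_bv. Qed.

Lemma neg_bound_bvk k c : neg_bound k (bv E k *+ c) = 0.
Proof. by rewrite (linMn (neg_bound_lin k)) neg_bound_bv b_diag oppr0 mul0rn. Qed.
Lemma pos_bound_bvk k c : pos_bound k (bv E k *+ c) = 0.
Proof. by rewrite (linMn (pos_bound_lin k)) pos_bound_bv b_diag mul0rn. Qed.

(** The k-th coordinate of n in the mutated basis is [neg_bound k n - bx E k n], so [lo_bounded]
    means that n lies in both cones. Likewise [hi_bounded] means that n lies in the old cone and its
    image under the inverse shear in the new one. *)
Definition lo_bounded k n := bmem E n && (bx E k n <= neg_bound k n).
Definition hi_bounded k n := bmem E n && (bx E k n <= pos_bound k n).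
Definition reduced k n := lo_bounded k n && hi_bounded k n.

Lemma lo_bounded_closed k : aclosed (lo_bounded k).
Proof.
move=> n m /andP[h1 h2] /andP[h3 h4]; apply/andP; split; first exact: bmemD.
by rewrite bxD [neg_bound _ _]neg_bound_lin; apply: lerD.
Qed.
Lemma hi_bounded_closed k : aclosed (hi_bounded k).
Proof.
move=> n m /andP[h1 h2] /andP[h3 h4]; apply/andP; split; first exact: bmemD.
by rewrite bxD [pos_bound _ _]pos_bound_lin; apply: lerD.
Qed.

Definition axis n := [exists i, n == bv E i *+ `|bx E i n|].
Lemma axis_bv i a : axis (bv E i *+ a).
Proof. by apply/existsP; exists i; rewrite absbxMn. Qed.

Lemma axisP n : axis n -> exists i a, n = bv E i *+ a.
Proof. by case/existsP=> i /eqP h; exists i, `|bx E i n|%N. Qed.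

(** A linear form that is nonzero on every nonzero cone element, hence a test direction for [logder]
    usable at every exponent. *)
Definition total n : int := \sum_i 1 * bx E i n.

Lemma total_lin : lin total. Proof. exact: sum_bx_lin. Qed.

Variables (K : realFieldType) (q : K) (hq : q != 0).
Hypothesis q1 : 1 < q.
Notation C := (bcone E).
Notation chi := (qchi w hq).
Notation ser := (ser chi C).
Implicit Types (u : ser).

Definition vq k : K := q^-1 ^+ delta k.

Lemma q_gt0 : 0 < q. Proof. exact: lt_trans q1. Qed.

Lemma vq_gt0 k : 0 < vq k.
Proof. by rewrite exprn_gt0 // invr_gt0 q_gt0. Qed.
Lemma vq_lt1 k : vq k < 1.
Proof.
rewrite exprn_ilt1 ?invr_ge0 ?(ltW q_gt0) //; first by rewrite -lt0n.
by rewrite invf_lt1 // q_gt0.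
Qed.

Lemma chi_l k c n : chi (bv E k *+ c) n = q ^ (- ((delta k)%:Z * slope k n) * c%:Z).
Proof.
rewrite /=; congr (_ ^ _).
have hl : lin (fun m => w m n) by move=> x y; rewrite skDl.
by rewrite (linMn hl) w_bvl -mulr_natr natz.
Qed.

Lemma chi_r k c n : chi n (bv E k *+ c) = q ^ ((delta k)%:Z * slope k n * c%:Z).
Proof.
by rewrite /=; congr (_ ^ _); rewrite (linMn (sk_lin w n)) w_bv -mulr_natr natz.
Qed.

Lemma qXn (z : int) k c : 0 <= z ->
  q ^ (- ((delta k)%:Z * z) * c%:Z) = vq k ^+ (`|z| * c).
Proof.
move=> hz; rewrite /vq -exprM exprVn exprnN; congr (_ ^ _).
by rewrite -{1}(gez0_abs hz); lia.
Qed.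

Lemma qXp (z : int) k c : 0 <= z ->
  q ^ ((delta k)%:Z * z * c%:Z) = (vq k ^+ (`|z| * c))^-1.
Proof.
move=> hz; rewrite -qXn // invr_expz; congr (_ ^ _); ring.
Qed.

Definition Psi k : ser := ser_res chi C
  (fun n => if n == bv E k *+ `|bx E k n| then psi (vq k) `|bx E k n| else 0).

Lemma PsiMn k a : Psi k (bv E k *+ a) = psi (vq k) a.
Proof. by rewrite ser_resE /= bmem_bvMn absbxMn eqxx. Qed.

Lemma Psi_supp k n : Psi k n != 0 -> n = bv E k *+ `|bx E k n|.
Proof.
rewrite ser_resE; case: ifP => _; last by rewrite eqxx.
by case: ifP => [/eqP h _ //|_]; rewrite eqxx.
Qed.

Lemma Psi0 k : Psi k 0 = 1.
Proof. by have := PsiMn k 0; rewrite mulr0n => ->. Qed.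

Lemma Psi_off k n : n != bv E k *+ `|bx E k n| -> Psi k n = 0.
Proof. by apply: contraNeq => /Psi_supp h; apply/eqP. Qed.

Lemma PsiM_l k u n N : (`|bx E k n| < N)%N -> (Psi k * u) n =
  \sum_(c < N) psi (vq k) c * u (n - bv E k *+ c) * chi (bv E k *+ c) n.
Proof.
move=> hN; rewrite serME.
transitivity (\sum_(m <- [seq bv E k *+ c | c <- iota 0 N])
   Psi k m * u (n - m) * chi m (n - m)).
  apply: sum_seq_supp; first exact: cdec_uniq.
  - by rewrite map_inj_uniq ?iota_uniq //; apply: bvMn_inj.
  - move=> m; rewrite mem_cdec => /andP[/bmemP h1 /bmemP h2].
    case: (eqVneq (Psi k m) 0) => [->|/Psi_supp e _]; first by rewrite !mul0r eqxx.
    apply/mapP; exists `|bx E k m|%N => //; rewrite mem_iota add0n /=.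
    by have := h1 k; have := h2 k; rewrite (linB (bxD E k)); lia.
  - move=> m /mapP[c _ ->]; rewrite mem_cdec /= bmem_bvMn /=.
    apply: contraNT => h; rewrite (@cf_supp _ _ _ _ u) ?mulr0 ?mul0r //.
rewrite big_map (_ : iota 0 N = index_iota 0 N) ?big_mkord; last by rewrite /index_iota subn0.
apply: eq_bigr => c _.
by rewrite PsiMn !chi_l slope_sub.
Qed.

Lemma PsiM_r k u n N : (`|bx E k n| < N)%N -> (u * Psi k) n =
  \sum_(c < N) u (n - bv E k *+ c) * psi (vq k) c * chi n (bv E k *+ c).
Proof.
move=> hN; rewrite serME.
transitivity (\sum_(m <- [seq n - bv E k *+ c | c <- iota 0 N])
   u m * Psi k (n - m) * chi m (n - m)).
  apply: sum_seq_supp; first exact: cdec_uniq.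
  - rewrite map_inj_uniq ?iota_uniq // => x y /addrI/oppr_inj; exact: bvMn_inj.
  - move=> m; rewrite mem_cdec => /andP[/bmemP h1 /bmemP h2].
    case: (eqVneq (Psi k (n - m)) 0) => [->|/Psi_supp e _]; first by rewrite mulr0 mul0r eqxx.
    apply/mapP; exists `|bx E k (n - m)|%N; last by rewrite -e subKr.
    rewrite mem_iota add0n /=.
    by have := h1 k; have := h2 k; rewrite (linB (bxD E k)); lia.
  - move=> m /mapP[c _ ->]; rewrite mem_cdec subKr /= bmem_bvMn andbT.
    by apply: contraNT => h; rewrite (@cf_supp _ _ _ _ u) ?mul0r //.
rewrite big_map (_ : iota 0 N = index_iota 0 N) ?big_mkord; last by rewrite /index_iota subn0.
apply: eq_bigr => c _.
by rewrite subKr PsiMn !chi_r slope_sub.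
Qed.

Section Hop.
Variable k : I.
Notation s n := (slope k n).
Notation v := (vq k).
Notation ek := (bv E k).

(* Conjugation by Psi multiplies the line n + Z e_k by a polynomial in X_k when
   s n > 0 and divides by one when s n < 0: hop true and hop false turn a common
   "reduced" series into the two sides of hop false u * Psi k = Psi k * hop true u. *)
Definition hop_at (neg : bool) n := if neg then s n < 0 else 0 < s n.

Definition hop neg u : ser := ser_res chi C (fun n =>
  if hop_at neg n then \sum_(j < `|s n|.+1) bq v `|s n| j * u (n - ek *+ j) else u n).

Lemma hopE neg u n : hop neg u n =
  if hop_at neg n then \sum_(j < `|s n|.+1) bq v `|s n| j * u (n - ek *+ j) else u n.
Proof.
rewrite ser_resE; case: ifPn => // h; case: ifP => _; last by rewrite cf_supp.
rewrite big1 // => j _; rewrite (cf_supp u) ?mulr0 //.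
by apply: contra h => /sub_mem.
Qed.

Lemma shift_out u n t : (`|bx E k n| < t)%N -> u (n - ek *+ t) = 0.
Proof.
move=> h; apply: cf_supp; apply: (@bmem_bx_lt0 _ _ _ _ k); rewrite bx_sub; lia.
Qed.

Lemma hopN neg u n N : hop_at neg n -> (`|bx E k n| < N)%N ->
  hop neg u n = \sum_(j < N) bq v `|s n| j * u (n - ek *+ j).
Proof.
move=> h hN; rewrite hopE h.
apply: (@sum_ord_ext _ (fun j => bq v `|s n| j * u (n - ek *+ j))) => j hj.
  by rewrite (bq_gt (vq_gt0 k) (vq_lt1 k)) ?mul0r.
by rewrite shift_out ?mulr0 //; lia.
Qed.

Lemma hop_not neg u n : ~~ hop_at neg n -> hop neg u n = u n.
Proof. by rewrite hopE => /negPf ->. Qed.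

Lemma hop_at_sub neg n c : hop_at neg (n - ek *+ c) = hop_at neg n.
Proof. by rewrite /hop_at slope_sub. Qed.

Lemma hop_conj u : hop false u * Psi k = Psi k * hop true u.
Proof.
apply: serP => n; case: (boolP (bmem E n)) => hn; last by rewrite !cf_supp.
have hx := elimT (bmemP _ _) hn k.
pose N := `|bx E k n|.+1; have hN : (`|bx E k n| < N)%N by [].
rewrite (PsiM_l _ hN) (PsiM_r _ hN).
pose U t := u (n - ek *+ t).
have hU t : (N <= t)%N -> U t = 0 by exact: shift_out.
(* This is [bq_psi] summed along the line through n. For either strict sign of [s n], one side of
   the claim is the left-hand sum and the other the right-hand one. *)
have key S : \sum_(c < N) (\sum_(j < N) bq v S j * U (c + j)%N) * psi v c / v ^+ (S * c) =
    \sum_(t < N) psi v t * U t * v ^+ (S * t).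
  transitivity (\sum_(c < N) \sum_(j < N) (bq v S j * psi v c / v ^+ (S * c)) * U (c + j)%N).
    by apply: eq_bigr => c _; rewrite -mulrA mulr_suml; apply: eq_bigr => j _; ring.
  rewrite (@sum_antidiag _ N (fun c j => bq v S j * psi v c / v ^+ (S * c)) U hU).
  apply: eq_bigr => t _; rewrite (bq_psi (vq_gt0 k) (vq_lt1 k)); ring.
have Hc neg (c : 'I_N) : hop_at neg n -> hop neg u (n - ek *+ c) =
   \sum_(j < N) bq v `|s n| j * U (c + j)%N.
  move=> h; rewrite (@hopN _ _ _ N) ?hop_at_sub ?slope_sub ?bx_sub //; last first.
    by have := ltn_ord c; rewrite /N; lia.
  by apply: eq_bigr => j _; rewrite /U mulrnDr opprD addrA.
case: (ltrgt0P (s n)) => hs.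
- transitivity (\sum_(c < N) (\sum_(j < N) bq v `|s n| j * U (c + j)%N) * psi v c
     / v ^+ (`|s n| * c)).
    by apply: eq_bigr => c _; rewrite Hc // chi_r qXp ?ltW.
  rewrite key; apply: eq_bigr => c _; rewrite chi_l qXn ?ltW // hop_not //.
  by rewrite hop_at_sub /hop_at -leNgt ltW.
- transitivity (\sum_(t < N) psi v t * U t * v ^+ (`|s n| * t)).
    apply: eq_bigr => c _; rewrite hop_not; last by rewrite hop_at_sub /hop_at -leNgt ltW.
    rewrite chi_r -[s n]opprK mulrN qXn ?abszN; last by lia.
    by rewrite /U; ring.
  rewrite -key; apply: eq_bigr => c _; rewrite Hc //.
  rewrite chi_l -mulrN qXp ?abszN; last by lia.
  by ring.
- apply: eq_bigr => c _; rewrite chi_l chi_r hs !(mulr0, oppr0, mul0r) !hop_not.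
  + by ring.
  + by rewrite hop_at_sub /hop_at hs ltxx.
  + by rewrite hop_at_sub /hop_at hs ltxx.
Qed.

Lemma hop_low neg d u u' : low d (u - u') -> low d (hop neg u - hop neg u') /\
  forall n, (cdeg C n <= d)%N -> hop neg u n - hop neg u' n = u n - u' n.
Proof.
move=> h.
have H n : (cdeg C n <= d)%N -> hop neg u n - hop neg u' n = u n - u' n.
  move=> hn; rewrite !hopE; case: ifP => // _.
  rewrite !big_ord_recl /= bq0 // !mul1r mulr0n subr0.
  set X := \sum_(_ < _) _; set Y := \sum_(_ < _) _.
  suff -> : X = Y by ring.
  apply: eq_bigr => j _; congr (_ * _); apply/eqP; rewrite -subr_eq0 -serBE.
  case: (boolP (bmem E (n - ek *+ bump 0 j))) => hm; last by rewrite cf_supp.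
  rewrite h //=; have := bdegD hm (bmem_bvMn E k (bump 0 j)); rewrite subrK => e.
  have : (`|bx E k (ek *+ bump 0 j)| <= bdeg E (ek *+ bump 0 j))%N by exact: bx_bdeg.
  by rewrite absbxMn /bump /=; move: hn; rewrite /= e /bump /=; lia.
by split=> // n hn; rewrite serBE (H n (ltnW hn)) -serBE h.
Qed.

Lemma hop0 neg u : hop neg u 0 = u 0.
Proof.
rewrite hop_not // /hop_at (lin0 (slope_lin k)).
by case: neg; rewrite ltxx.
Qed.

End Hop.

(** Where s < 0 the hop raises the k-th coordinate by at most |s|, and a reduced exponent leaves
    exactly that much room because [pos_bound = neg_bound + s]. *)
Lemma hop_lo_bounded k u : uni (reduced k) u -> uni (lo_bounded k) (hop k true u).
Proof.
move=> [u0 hu]; split=> [|n n0]; first by rewrite hop0.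
case: (boolP (hop_at k true n)) => h; last first.
  by rewrite hop_not // => /(hu _ n0)/andP[].
move=> hn; have hm := cf_mem hn; move: hn; rewrite hopE h => hn.
have [j hj] : exists j : 'I_(`|slope k n|.+1), u (n - bv E k *+ j) != 0.
  apply: contrapT => H; case/negP: hn; apply/eqP; rewrite big1 // => j _.
  case: (eqVneq (u (n - bv E k *+ j)) 0) => [->|e]; first by rewrite mulr0.
  by case: H; exists j.
rewrite /lo_bounded [bmem E n]hm /=; have hAp := pos_boundE k n; have hlt := ltn_ord j.
have h' : slope k n < 0 by [].
case: (eqVneq (n - bv E k *+ j) 0) => [/eqP|e].
  rewrite subr_eq0 => /eqP e; have : slope k n = 0.
    by rewrite e (linMn (slope_lin k)) slope_bvk mul0rn.
  by lia.
have /andP[_ /andP[_]] := hu _ e hj.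
rewrite bx_sub (linB (pos_bound_lin k)) pos_bound_bvk.
by lia.
Qed.

Lemma hop_hi_bounded k u : uni (reduced k) u -> uni (hi_bounded k) (hop k false u).
Proof.
move=> [u0 hu]; split=> [|n n0]; first by rewrite hop0.
case: (boolP (hop_at k false n)) => h; last first.
  by rewrite hop_not // => /(hu _ n0)/andP[].
move=> hn; have hm := cf_mem hn; move: hn; rewrite hopE h => hn.
have [j hj] : exists j : 'I_(`|slope k n|.+1), u (n - bv E k *+ j) != 0.
  apply: contrapT => H; case/negP: hn; apply/eqP; rewrite big1 // => j _.
  case: (eqVneq (u (n - bv E k *+ j)) 0) => [->|e]; first by rewrite mulr0.
  by case: H; exists j.
rewrite /hi_bounded [bmem E n]hm /=; have hAp := pos_boundE k n; have hlt := ltn_ord j.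
have h' : 0 < slope k n by [].
case: (eqVneq (n - bv E k *+ j) 0) => [/eqP|e].
  rewrite subr_eq0 => /eqP e; have : slope k n = 0.
    by rewrite e (linMn (slope_lin k)) slope_bvk mul0rn.
  by lia.
have /andP[/andP[_ +] _] := hu _ e hj.
rewrite bx_sub (linB (neg_bound_lin k)) neg_bound_bvk.
by lia.
Qed.

Definition axval n : K := \sum_i Psi i n.

Lemma axval_bv i a : (0 < a)%N -> axval (bv E i *+ a) = psi (vq i) a.
Proof.
move=> ha; rewrite /axval (bigD1 i) //= PsiMn big1 ?addr0 // => j ij.
apply: Psi_off; rewrite bxMn (negPf ij) mulr0n bvMn_eq0; lia.
Qed.

(* At th = w n the series X^m occurring in g_0 commute with X^n, so logder is the
   additive (Lie algebra) coordinate of g_0 in direction n. *)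
Definition spec (g : ser) := [/\ g 0 = 1,
  forall i a, g (bv E i *+ a) = psi (vq i) a &
  forall n, bmem E n -> n != 0 -> ~~ axis n -> forall la, lin la ->
    logder la n (zer_part (w n) g) = 0].

Lemma total_neq0 n : bmem E n -> n != 0 -> (total n)%:~R != 0 :> K.
Proof.
move=> /bmemP h n0; rewrite intr_eq0; apply: contra n0 => /eqP e.
have hz i : bx E i n = 0.
  have : \sum_j bx E j n = 0 by rewrite -[RHS]e; apply: eq_bigr => j _; rewrite mul1r.
  move/eqP; rewrite psumr_eq0 => [/allP/(_ i)|j _]; last exact: h.
  by rewrite mem_index_enum => /(_ isT)/eqP.
by apply/eqP/(bx_inj (E := E)) => i; rewrite hz (lin0 (bxD E i)).
Qed.

Lemma spec_uniq g g' : spec g -> spec g' -> g = g'.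
Proof.
move=> [g0 ga series_l] [g0' ga' gl']; apply: low_eq; elim=> [|d IH]; first exact: low0.
move=> n hn; rewrite serBE; case: (boolP (bmem E n)) => hm; last first.
  by rewrite !cf_supp // subrr.
case: (eqVneq n 0) => [->|n0]; first by rewrite g0 g0' subrr.
case: (boolP (axis n)) => [/axisP[i [a ->]]|ha]; first by rewrite ga ga' subrr.
have := logder_top (sk_lin w n) total_lin g0 g0' IH hn n0 (skxx w n).
rewrite (series_l _ hm n0 ha) ?(gl' _ hm n0 ha) ?subrr; try exact: total_lin.
by move/esym/eqP; rewrite mulf_eq0 (negPf (total_neq0 hm n0)) => /eqP.
Qed.

Lemma uni_Psi (p : pred M) k : (forall c, (0 < c)%N -> p (bv E k *+ c)) -> uni p (Psi k).
Proof.
move=> h; split=> [|n n0 /Psi_supp e]; first exact: Psi0.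
rewrite e; apply: h; rewrite lt0n; apply: contra n0 => /eqP e0.
by rewrite e e0 mulr0n.
Qed.

Lemma logder_Psi la k n : n != 0 -> ~~ axis n -> logder la n (Psi k) = 0.
Proof.
move=> n0 hax; case: (boolP (bmem E n)) => hm; last exact: cf_supp.
pose P m := bmem E m && [forall j, (j != k) ==> (bx E j m == 0)].
apply: (@logder_supp _ _ _ _ _ _ P) => //.
- move=> x y /andP[hx /forallP hx'] /andP[hy /forallP hy']; rewrite /P bmemD //=.
  apply/forallP => j; apply/implyP => jk; rewrite bxD.
  by have := hx' j; have := hy' j; rewrite jk /= => /eqP -> /eqP ->.
- apply: uni_Psi => c hc; rewrite /P bmem_bvMn; apply/forallP => j.
  by apply/implyP => /negPf jk; rewrite bxMn jk.
- apply: contra hax => /andP[_ /forallP hj]; apply/existsP; exists k; apply/eqP.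
  apply: (bx_inj (E := E)) => j; rewrite bxMn; case: eqVneq => [->|jk].
    by have := elimT (bmemP _ _) hm k; lia.
  by have := hj j; rewrite jk => /eqP.
Qed.

Section Exist.
Variable k : I.
Notation ek := (bv E k).

(** Resetting the constant term to 1 makes the operator below usable on every series, as the
    contraction argument requires. *)
Definition normed u : ser := 1 + proj predT u.
Definition seed_series u : ser := Psi k * hop k true (normed u).

Lemma normed0 u : normed u 0 = 1.
Proof. by rewrite serDE proj0 ser1E eqxx addr0. Qed.
Lemma normed_neq0 u n : n != 0 -> normed u n = u n.
Proof. by move=> h; rewrite serDE projE h ser1E (negPf h) add0r. Qed.
Lemma normed_id u : u 0 = 1 -> normed u = u.
Proof.
by move=> u0; apply: serP => n; case: (eqVneq n 0) => [->|/normed_neq0] //; rewrite normed0.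
Qed.

Lemma seed_series0 u : seed_series u 0 = 1.
Proof. by rewrite ser0M Psi0 hop0 normed0 mulr1. Qed.

Lemma seed_series_low d u u' : low d (u - u') -> low d (seed_series u - seed_series u') /\
  forall n, (cdeg C n <= d)%N -> n != 0 -> seed_series u n - seed_series u' n = u n - u' n.
Proof.
move=> h; have hN : low d (normed u - normed u').
  rewrite /normed; have -> x y : (1 + x : ser) - (1 + y) = x - y.
    by apply: serP => m; rewrite !(serDE, serNE); ring.
  exact: proj_low.
have [h1 h2] := @hop_low k true d _ _ hN.
rewrite /seed_series -mulrBr; split; first exact: lowMr.
move=> n hn n0; rewrite -serBE -mulrBr (mul_lowr _ h1) // Psi0 mul1r serBE h2 //.
by rewrite !normed_neq0.
Qed.

(* The n-th condition of spec reads total n * u n + (terms in u of lower degree) = 0. *)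
Definition step_at u n : K :=
  if n == 0 then 1 else if ~~ reduced k n then 0 else if axis n then axval n else
  u n - (total n)%:~R^-1 * logder total n (zer_part (w n) (seed_series u)).

Lemma step_contracting (F : ser -> ser) :
  (forall u n, F u n = if bmem E n then step_at u n else 0) -> contracting F.
Proof.
move=> hF d u u' h n hn; rewrite serBE (hF u) (hF u').
case: (boolP (bmem E n)) => hm; last by rewrite subrr.
rewrite /step_at; case: (eqVneq n 0) => [_|n0]; first by rewrite subrr.
case: (~~ reduced k n); first by rewrite subrr.
case: (axis n); first by rewrite subrr.
have [] := seed_series_low h; have := seed_series0 u; have := seed_series0 u'.
generalize (seed_series u) (seed_series u') => A B B0 A0 h1 h2.
have := logder_top (sk_lin w n) total_lin A0 B0 h1 hn n0 (skxx w n).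
rewrite h2 //; generalize (logder total n (zer_part (w n) A)) => x.
generalize (logder total n (zer_part (w n) B)) => y.
generalize (u n) (u' n) => z z' e.
transitivity ((z - z') - (total n)%:~R^-1 * (x - y)); first by ring.
by rewrite e mulKf ?total_neq0 // subrr.
Qed.

(** The recursion imposes the condition at reduced n only. Elsewhere it is automatic: for slope > 0
    the factor [Psi k] is absorbed on the left and n lies outside the support of [hop k true u]; for
    slope < 0 it is absorbed on the right of [hop k false u]; for slope 0 both bounds coincide and
    [Psi k] contributes only on its axis. *)
Lemma cluster_ex : exists u, uni (reduced k) u /\ spec (Psi k * hop k true u).
Proof.
pose F u : ser := ser_res chi C (step_at u).
have FE u n : F u n = if bmem E n then step_at u n else 0 by exact: ser_resE.
have [u hu] := contracting_fix (step_contracting FE).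
have uE n : u n = if bmem E n then step_at u n else 0 by rewrite -FE hu.
clear hu FE F.
have u0 : u 0 = 1 by rewrite uE bmem0 /step_at eqxx.
have uP : uni (reduced k) u.
  split=> // n n0; rewrite uE /step_at (negPf n0); case: ifP; rewrite ?eqxx // => _.
  by case: ifPn; rewrite ?eqxx // negbK.
exists u; split=> //.
have gE : seed_series u = Psi k * hop k true u by rewrite /seed_series normed_id.
have u_ax i a : i != k -> u (bv E i *+ a) = psi (vq i) a.
  case: a => [|a] ik; first by rewrite mulr0n u0.
  rewrite uE bmem_bvMn /step_at bvMn_eq0 axis_bv axval_bv //=.
  rewrite /reduced /lo_bounded /hi_bounded bmem_bvMn /= bxMn eq_sym (negPf ik).
  rewrite (linMn (neg_bound_lin k)) (linMn (pos_bound_lin k)) neg_bound_bv pos_bound_bv.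
  have pp c : 0 <= pospart c by rewrite /pospart; case: ifP.
  by rewrite !mulrn_wge0.
(* [neg_bound] vanishes along e_k, so positive multiples of e_k are never reduced: that axis is
   carried entirely by [Psi k]. *)
have u_axk a : (0 < a)%N -> u (ek *+ a) = 0.
  move=> ha; rewrite uE bmem_bvMn /step_at bvMn_eq0.
  have -> : reduced k (ek *+ a) = false.
    apply/negP => /andP[/andP[_]]; rewrite bxMn eqxx neg_bound_bvk; lia.
  by case: eqP => // e; lia.
have h1 := hop_lo_bounded uP; have h2 := hop_hi_bounded uP.
have g0 : (Psi k * hop k true u) 0 = 1 by rewrite -gE seed_series0.
split=> [//|i a|n hm n0 hax la hla].
- case: (eqVneq i k) => [->|ik].
    rewrite (@PsiM_l k _ _ a.+1) ?absbxMn // big_ord_recr /= big1 => [|c _].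
      rewrite add0r subrr hop0 u0 mulr1 -[q ^ _]/(chi (ek *+ a) (ek *+ a)).
      by rewrite chi_l (linMn (slope_lin k)) slope_bvk mul0rn mulr0 oppr0 mul0r mulr1.
    have hc := ltn_ord c.
    rewrite -mulrnBr 1?ltnW // hop_not ?u_axk ?subn_gt0 ?mulr0 ?mul0r //.
    by rewrite /hop_at (linMn (slope_lin k)) slope_bvk mul0rn ltxx.
  have hN : (`|bx E k (bv E i *+ a)| < 1)%N by rewrite bxMn eq_sym (negPf ik).
  rewrite (PsiM_l _ hN) big_ord1 mulr0n subr0 bich0l mulr1 mul1r.
  rewrite -u_ax //; case: (boolP (hop_at k true (bv E i *+ a))) => h.
    by rewrite (hopN _ h hN) big_ord1 bq0 mulr0n subr0 mul1r.
  by rewrite hop_not.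
- have th_k c : w n (ek *+ c) = ((delta k)%:Z * slope k n) *+ c.
    by rewrite (linMn (sk_lin w n)) w_bv.
  have hdk := hd k; have hA := pos_boundE k n.
  have hlw := sk_lin w n.
  case: (boolP (reduced k n)) => hP.
    have e : logder total n (zer_part (w n) (seed_series u)) = 0.
      have := uE n; rewrite /step_at hm (negPf n0) hP (negPf hax) /=.
      move: (u n) (total_neq0 hm n0) => z t0 /eqP.
      rewrite -subr_eq0 opprB addrCA subrr addr0 mulf_eq0 invr_eq0 (negPf t0).
      by move/eqP.
    rewrite gE in e.
    have hz := zer_uni hlw g0.
    (* The recursion tested only [total]; proportionality of logarithmic derivatives extends the
       vanishing to every [la]. *)
    have := logder_prop hla total_lin hz; rewrite e mulr0 => /esym/eqP.
    by rewrite mulf_eq0 (negPf (total_neq0 hm n0)) => /eqP.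
  case: (ltrgt0P (slope k n)) => hs.
  + rewrite zer_mul_gt //; [| by case: h1 | apply: uni_Psi => c hc; rewrite th_k].
      apply: logder_supp (zer_supp hlw (@lo_bounded_closed k) h1) n0 _; first exact: lo_bounded_closed.
      by apply: contra hP; rewrite /reduced /lo_bounded /hi_bounded hm /= hA; lia.
    by rewrite pmulrn_lgt0 //; lia.
  + rewrite -hop_conj zer_mul_lt //; [| by case: h2 | apply: uni_Psi => c hc; rewrite th_k].
      apply: logder_supp (zer_supp hlw (@hi_bounded_closed k) h2) n0 _; first exact: hi_bounded_closed.
      by apply: contra hP; rewrite /reduced /lo_bounded /hi_bounded hm /= hA; lia.
    by rewrite pmulrn_llt0 //; nia.
  + have uPsi : uni (fun m => w n m == 0) (Psi k).
      by apply: uni_Psi => c hc; rewrite th_k hs mulr0 mul0rn.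
    have h10 : hop k true u 0 = 1 by case: h1.
    rewrite zer_mul_eql // logderM //; last exact: zer_uni.
    rewrite [X in _ + X](logder_supp _ (@lo_bounded_closed k) (zer_supp hlw (@lo_bounded_closed k) h1) n0).
      rewrite addr0.
      exact: logder_Psi.
    by apply: contra hP; rewrite /reduced /lo_bounded /hi_bounded hm /= hA hs addr0 => ->.
Qed.

End Exist.
End Cluster.

(** * Mutation *)

Section MutBasis.
Variables (M : zmodType) (I : finType) (E : basis M I) (k : I) (c : I -> int).

Definition mbv i := if i == k then - bv E k else bv E i + bv E k *~ c i.
Definition mbx i n := if i == k then - bx E k n + \sum_(j | j != k) c j * bx E j n
  else bx E i n.

Lemma mbxD i : lin (mbx i).
Proof.
move=> n m; rewrite /mbx; case: ifP => _; last exact: bxD.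
rewrite bxD opprD -!addrA; congr (_ + _); rewrite addrCA; congr (_ + _).
by rewrite -big_split /=; apply: eq_bigr => j _; rewrite bxD mulrDr.
Qed.

Lemma mbxv i j : mbx i (mbv j) = (i == j)%:Z.
Proof.
have hs (t : I -> int) : t k = 0 -> \sum_(l | l != k) c l * t l = \sum_l c l * t l.
  by move=> tk; rewrite [RHS](bigD1 k) //= tk mulr0 add0r.
rewrite /mbx /mbv; case: (eqVneq i k) => [->|ik].
  case: (eqVneq j k) => [jk|jk].
  rewrite (linN (bxD E k)) bxv eqxx opprK big1 ?addr0 // => l /negPf lk.
  by rewrite (linN (bxD E l)) bxv lk oppr0 mulr0.
- have kj : (k == j) = false by rewrite eq_sym (negPf jk).
  rewrite bxD (linMz _ _ (bxD E k)) !bxv eqxx kj add0r mulr1.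
  rewrite (bigD1 j) //= big1 => [|l /andP[lk lj]].
    rewrite bxD (linMz _ _ (bxD E j)) !bxv eqxx (negPf jk) /=; ring.
  by rewrite bxD (linMz _ _ (bxD E l)) !bxv (negPf lk) (negPf lj) !mulr0.
case: (eqVneq j k) => [->|jk].
  by rewrite (linN (bxD E i)) bxv (negPf ik) oppr0.
by rewrite bxD (linMz _ _ (bxD E i)) !bxv (negPf ik) mulr0 addr0.
Qed.

Lemma mbsum n : n = \sum_i mbv i *~ mbx i n.
Proof.
rewrite (bigD1 k) //= /mbv /mbx eqxx.
rewrite (eq_bigr (fun i => bv E i *~ bx E i n + bv E k *~ (c i * bx E i n))); last first.
  by move=> i /negPf ->; rewrite mulrzDl -mulrzA.
rewrite big_split /=; set X := \sum_(j | j != k) c j * bx E j n.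
have -> : \sum_(i | i != k) bv E k *~ (c i * bx E i n) = bv E k *~ X.
  by rewrite /X raddf_sum.
rewrite mulNrz -mulrNz opprD opprK mulrzDr mulrNz [X in _ + X]addrC addrA subrK.
by rewrite {1}(bsum E n) (bigD1 k).
Qed.

Definition mut_basis : basis M I := Basis mbxD mbxv mbsum.
End MutBasis.

Definition mutb (I : finType) (k : I) (b : I -> I -> int) : I -> I -> int :=
  fun i j => if (i == k) || (j == k) then - b i j
    else b i j + (pospart (- b i k) * b k j + b i k * pospart (b k j)).

(* the two sign choices in the mutation of a basis, e_i + [+-b_ki]_+ e_k *)
Definition mcoef (I : finType) (b : I -> I -> int) (k : I) (sg : bool) : I -> int :=
  fun i => pospart (if sg then b k i else - b k i).

Definition compat (M : zmodType) (I : finType) (w : skewform M) (delta : I -> nat)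
  (E : basis M I) (b : I -> I -> int) :=
  forall i j, w (bv E i) (bv E j) = - ((delta i)%:Z * b i j).

Section Compat.
Variables (M : zmodType) (I : finType) (w : skewform M) (delta : I -> nat).
Hypothesis hd : forall i, (0 < delta i)%N.

Lemma pospart_pmul (a : nat) z : pospart (a%:Z * z) = a%:Z * pospart z.
Proof.
case: a => [|a]; first by rewrite !mul0r.
by rewrite /pospart pmulr_rge0 //; case: ifP; rewrite ?mulr0.
Qed.

(** The bases for the two signs differ by an isometry of w (the shear [tau] below), so both have the
    matrix [mutb k b]. This leaves the sign free at each step of a path. *)
Lemma compat_mut (E : basis M I) b k sg : compat w delta E b ->
  compat w delta (mut_basis E k (mcoef b k sg)) (mutb k b).
Proof.
move=> hb i j; have hC := compatC hb; have hkk : b k k = 0 by exact: (b_diag hd hb k).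
have wz a x y : w (x *~ a) y = a * w x y.
  by apply: (linMz x a (fun x1 x2 => skDl w x1 x2 y)).
have wz' a x y : w x (y *~ a) = a * w x y by apply: linMz; apply: sk_lin.
have wN x y : w (- x) y = - w x y by apply: (linN (fun x1 x2 => skDl w x1 x2 y)).
have wN' x y : w x (- y) = - w x y by apply: linN; apply: sk_lin.
rewrite /= /mbv /mutb; case: (eqVneq i k) => [->|ik]; case: (eqVneq j k) => [->|jk] /=.
- by rewrite wN wN' opprK skxx hkk oppr0 mulr0 oppr0.
- by rewrite wN skDr wz' skxx mulr0 addr0 hb; ring.
- by rewrite wN' skDl wz skxx mulr0 addr0 hb; ring.
rewrite !skDl !skDr !wz !wz' skxx !mulr0 !addr0 !hb.
have e1 : (delta k)%:Z * mcoef b k sg i = (delta i)%:Z * pospart (if sg then - b i k else b i k).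
  rewrite -!pospart_pmul; congr pospart; case: sg; rewrite ?mulrN hC; lia.
have -> : mcoef b k sg i * - ((delta k)%:Z * b k j) =
   - ((delta k)%:Z * mcoef b k sg i * b k j) by ring.
rewrite e1 /mcoef; case: sg {e1}; first by ring.
rewrite [pospart (b k j)]pospartE.
have -> : pospart (b i k) = pospart (- b i k) + b i k by apply: pospartE.
by ring.
Qed.
End Compat.

Section Mutation.
Variables (M : zmodType) (I : finType) (w : skewform M) (delta : I -> nat).
Hypothesis hd : forall i, (0 < delta i)%N.
Variables (E : basis M I) (b : I -> I -> int) (hb : compat w delta E b) (k : I).
Implicit Types (n m : M).
Notation E' := (mut_basis E k (mcoef b k false)).
Notation b' := (mutb k b).
Notation s n := (slope E b k n).

Lemma mut_compat : compat w delta E' b'.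
Proof. exact: compat_mut. Qed.

(** A transvection along e_k, hence an isometry of w; it carries the mutated basis of sign [false]
    to that of sign [true]. *)
Definition tau n := n + bv E k *~ s n.
Definition tau' n := n - bv E k *~ s n.

Lemma s_bvz a : s (bv E k *~ a) = 0.
Proof. by rewrite (linMz _ _ (slope_lin E b k)) (slope_bvk hd hb) mulr0. Qed.

Lemma s_tau n : s (tau n) = s n.
Proof. by rewrite /tau slope_lin s_bvz addr0. Qed.

Lemma s_tau' n : s (tau' n) = s n.
Proof. by rewrite /tau' (linB (slope_lin E b k)) s_bvz subr0. Qed.

Lemma tauK : cancel tau tau'.
Proof. by move=> n; rewrite {1}/tau' s_tau /tau addrK. Qed.
Lemma tauK' : cancel tau' tau.
Proof. by move=> n; rewrite {1}/tau s_tau' /tau' subrK. Qed.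
Lemma tauD n m : tau (n + m) = tau n + tau m.
Proof. by rewrite /tau slope_lin mulrzDr addrACA. Qed.
Lemma tauw n m : w (tau n) (tau m) = w n m.
Proof.
have wz a x y : w (x *~ a) y = a * w x y.
  by apply: (linMz x a (fun x1 x2 => skDl w x1 x2 y)).
have wz' a x y : w x (y *~ a) = a * w x y by apply: linMz; apply: sk_lin.
rewrite /tau !skDl !skDr !wz !wz' skxx (w_bv hb) (w_bvl hb); ring.
Qed.
Lemma tau_bvk : tau (bv E k) = bv E k.
Proof. by rewrite /tau (slope_bvk hd hb) mulr0z addr0. Qed.

Lemma s_opp n : slope E' b' k n = - s n.
Proof.
have h : (delta k)%:Z != 0 by have := hd k; lia.
apply: (mulfI h); rewrite -(w_bv mut_compat) /= /mbv eqxx (linN (sk_lin w n)) (w_bv hb).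
by rewrite mulrN.
Qed.

Lemma bxk' n : bx E' k n = neg_bound E b k n - bx E k n.
Proof.
rewrite /= /mbx eqxx /neg_bound [in RHS](bigD1 k) //= (b_diag hd hb) oppr0 mul0r add0r addrC.
by congr (_ - _).
Qed.

Lemma bxi' i n : i != k -> bx E' i n = bx E i n.
Proof. by rewrite /= /mbx => /negPf ->. Qed.

Lemma bvk' : bv E' k = - bv E k.
Proof. by rewrite /= /mbv eqxx. Qed.

Lemma bmem' n : bmem E n -> bx E k n <= neg_bound E b k n -> bmem E' n.
Proof.
move=> /bmemP h1 h2; apply/bmemP => i; case: (eqVneq i k) => [->|ik].
  by rewrite bxk'; lia.
by rewrite bxi'.
Qed.

Lemma lo_bounded_mem n : lo_bounded E b k n -> bmem E' n.
Proof. by move=> /andP[]; apply: bmem'. Qed.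

Lemma bx_tau' i n : i != k -> bx E i (tau' n) = bx E i n.
Proof.
move=> /negPf ik; rewrite /tau' (linB (bxD E i)) (linMz _ _ (bxD E i)) bxv ik.
by rewrite mulr0 subr0.
Qed.

Lemma hi_bounded_mem n : hi_bounded E b k n -> bmem E' (tau' n).
Proof.
move=> /andP[/bmemP h1 h2]; apply/bmemP => i; case: (eqVneq i k) => [->|ik].
  rewrite bxk' /tau' (linB (bxD E k)) (linMz _ _ (bxD E k)) bxv eqxx mulr1.
  rewrite (linB (neg_bound_lin E b k)) (linMz _ _ (neg_bound_lin E b k)) neg_bound_bv (b_diag hd hb).
  have p0 : pospart 0 = 0 by [].
  by rewrite oppr0 p0 mulr0 subr0; have := pos_boundE E b k n; lia.
by rewrite bxi' // bx_tau'.
Qed.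

Lemma bv_pos i a : i != k -> 0 <= b k i -> bv E' i *+ a = bv E i *+ a.
Proof.
move=> /negPf ik h; congr (_ *+ _); rewrite /= /mbv ik /mcoef /pospart.
case: (lerP 0 (- b k i)) => hh; last by rewrite mulr0z addr0.
have -> : b k i = 0 by lia.
by rewrite oppr0 mulr0z addr0.
Qed.

(** Together with [bv_pos] this matches the axes other than the k-th: directly if b_ki >= 0, after
    the shear if b_ki < 0. *)
Lemma tau_bv_neg i a : i != k -> b k i < 0 -> tau (bv E' i *+ a) = bv E i *+ a.
Proof.
move=> /negPf ik h; have -> : bv E' i *+ a = bv E i *+ a - bv E k *~ (b k i *+ a).
  rewrite /= /mbv ik /mcoef /pospart; case: (lerP 0 (- b k i)) => hh; last by lia.
  rewrite mulrnDl; congr (_ + _); rewrite pmulrn -mulrzA -mulrNz; congr (_ *~ _).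
  by rewrite -mulNrn -[RHS]mulr_natr natz.
rewrite /tau (linB (slope_lin E b k)) s_bvz subr0 (linMn (slope_lin E b k)) slope_bv.
by rewrite subrK.
Qed.

Lemma s_bvMn i a : s (bv E i *+ a) = b k i *+ a.
Proof. by rewrite (linMn (slope_lin E b k)) slope_bv. Qed.

Variables (K : realFieldType) (q : K) (hq : q != 0) (q1 : 1 < q).
Notation chi := (qchi w hq).
Notation v := (vq delta q k).

Section Transfer.
Variable u : ser chi (bcone E).
Hypothesis hu : uni (reduced E b k) u.
Hypothesis hg : spec delta (Psi w E delta hq k * hop delta b k true u).

(* the reduced series of the mutated basis *)
Definition up : ser chi (bcone E') :=
  ser_res chi (bcone E') (fun n => if s n < 0 then u (tau n) else u n).

(** Truncation to the new cone discards nothing: a reduced exponent lies in it both as it stands and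
    after [tau']. *)
Lemma upE n : up n = if s n < 0 then u (tau n) else u n.
Proof.
rewrite ser_resE; case: ifPn => // hn; symmetry; apply/eqP; apply: contraNT hn.
have P0_mem m : u m != 0 -> reduced E b k m.
  case: (eqVneq m 0) => [-> _|m0]; last exact: (proj2 hu).
  rewrite /reduced /lo_bounded /hi_bounded bmem0 (lin0 (bxD E k)) (lin0 (neg_bound_lin E b k)) (lin0 (pos_bound_lin E b k)).
  by [].
case: ifP => _ /P0_mem/andP[h1 h2]; last exact: lo_bounded_mem.
by have := hi_bounded_mem h2; rewrite tauK.
Qed.

Lemma sub_bvk' n j : n - bv E' k *+ j = n + bv E k *+ j.
Proof. by rewrite bvk' mulNrn opprK. Qed.

(** As e'_k = -e_k, the new hop runs through the same exponents backwards. [bq_pal] makes the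
    coefficients agree, and the offset [s n] is the one that [tau] builds into [up]. *)
Lemma trel_hop_true : trel id (hop delta b k true u) (hop delta b' k false up).
Proof.
move=> n; rewrite !hopE /hop_at s_opp oppr_gt0 abszN; case: ifP => h; last by rewrite upE h.
rewrite (reindex_inj rev_ord_inj) /=; apply: eq_bigr => j _.
have hj : (j <= `|s n|)%N by rewrite -ltnS.
rewrite subSS (bq_pal (vq_gt0 delta q1 k) (vq_lt1 hd q1 k)) //; congr (_ * _).
rewrite sub_bvk' upE slope_lin (linMn (slope_lin E b k)) (slope_bvk hd hb) mul0rn addr0 h.
congr (u _); rewrite /tau slope_lin (linMn (slope_lin E b k)) (slope_bvk hd hb) mul0rn addr0.
rewrite -addrA; congr (_ + _).
have -> : bv E k *~ s n = - (bv E k *+ `|s n|).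
  by rewrite pmulrn -mulrNz; congr (_ *~ _); lia.
by rewrite mulrnBr // opprB.
Qed.

Lemma trel_hop_false : trel tau (hop delta b k false u) (hop delta b' k true up).
Proof.
move=> n; rewrite !hopE /hop_at s_opp oppr_lt0 s_tau abszN; case: ifP => h; last first.
  rewrite upE; case: ifP => h' //; congr (u _).
  by have -> : tau n = n by rewrite /tau (_ : s n = 0) ?mulr0z ?addr0 //; lia.
rewrite (reindex_inj rev_ord_inj) /=; apply: eq_bigr => j _.
have hj : (j <= `|s n|)%N by rewrite -ltnS.
rewrite subSS (bq_pal (vq_gt0 delta q1 k) (vq_lt1 hd q1 k)) //; congr (_ * _).
rewrite sub_bvk' upE slope_lin (linMn (slope_lin E b k)) (slope_bvk hd hb) mul0rn addr0.
rewrite ltNge (ltW h) /=; congr (u _); rewrite /tau -addrA; congr (_ + _).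
have -> : bv E k *~ s n = bv E k *+ `|s n| by rewrite -[in LHS](gtz0_abs h) -pmulrn.
by rewrite mulrnBr // opprB addrC subrK.
Qed.

Notation hT := (hop delta b k true u).
Notation hF := (hop delta b k false u).
Notation hpF := (hop delta b' k false up).
Notation hpT := (hop delta b' k true up).
Notation Pk := (Psi w E delta hq k).
Notation Pk' := (Psi w E' delta hq k).

Lemma hT_lo_bounded : uni (lo_bounded E b k) hT. Proof. exact: (hop_lo_bounded hd hb q1 hu). Qed.
Lemma hF_hi_bounded : uni (hi_bounded E b k) hF. Proof. exact: (hop_hi_bounded hd hb q1 hu). Qed.
Lemma hT0 : hT 0 = 1. Proof. by case: hT_lo_bounded. Qed.
Lemma hF0 : hF 0 = 1. Proof. by case: hF_hi_bounded. Qed.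
Lemma hpF0 : hpF 0 = 1. Proof. by rewrite -trel_hop_true hT0. Qed.
Lemma hpT0 : hpT 0 = 1. Proof. by rewrite -trel_hop_false (tau0 tauD) hF0. Qed.

(* the tilt: series_l belongs to the basis E and series_r to the mutated basis E' *)
Definition series_l : ser chi (bcone E) := Pk * hT.
Definition series_r : ser chi (bcone E') := hpF * Pk'.

Lemma series_lE : series_l = hF * Pk. Proof. by rewrite /series_l (hop_conj hd hb q1). Qed.
Lemma series_rE : series_r = Pk' * hpT. Proof. by rewrite /series_r (hop_conj hd mut_compat q1). Qed.

Lemma series_r0 : series_r 0 = 1. Proof. by rewrite ser0M Psi0 hpF0 mulr1. Qed.

Lemma tau_th th : lin th -> lin (th \o tau).
Proof. by move=> ht n m /=; rewrite tauD ht. Qed.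

Lemma zer_series_l_pos th : lin th -> 0 < th (bv E k) -> zer_part th series_l = zer_part th hT.
Proof.
by move=> ht hk; apply: (zer_mul_gt ht hT0); apply: uni_Psi => c hc; rewrite (linMn ht) pmulrn_lgt0.
Qed.

Lemma zer_series_r_pos th : lin th -> 0 < th (bv E k) -> zer_part th series_r = zer_part th hpF.
Proof.
move=> ht hk; apply: (zer_mul_lt ht hpF0); apply: uni_Psi => c hc.
by rewrite (linMn ht) pmulrn_llt0 // bvk' (linN ht); lia.
Qed.

Lemma zer_series_l_neg th : lin th -> th (bv E k) < 0 -> zer_part th series_l = zer_part th hF.
Proof.
move=> ht hk; rewrite series_lE; apply: (zer_mul_lt ht hF0); apply: uni_Psi => c hc.
by rewrite (linMn ht) pmulrn_llt0.
Qed.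

Lemma zer_series_r_neg th : lin th -> th (bv E k) < 0 -> zer_part th series_r = zer_part th hpT.
Proof.
move=> ht hk; rewrite series_rE; apply: (zer_mul_gt ht hpT0); apply: uni_Psi => c hc.
by rewrite (linMn ht) pmulrn_lgt0 // bvk' (linN ht); lia.
Qed.

Lemma idD n m : id (n + m) = id n + id m :> M. Proof. by []. Qed.
Lemma idK : cancel (@id M) id. Proof. by []. Qed.
Lemma idw n m : w (id n) (id m) = w n m. Proof. by []. Qed.

Lemma trel_zer_true th : lin th -> trel id (zer_part th hT) (zer_part th hpF).
Proof. by move=> ht; apply: (rel_zer idD idK idK idw ht hT0 trel_hop_true). Qed.

Lemma trel_zer_false th : lin th -> trel tau (zer_part th hF) (zer_part (th \o tau) hpT).
Proof. by move=> ht; apply: (rel_zer tauD tauK tauK' tauw ht hF0 trel_hop_false). Qed.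

Lemma w_bvk_pos n : (0 < w n (bv E k)) = (0 < s n).
Proof. by rewrite (w_bv hb) pmulr_rgt0 //; have := hd k; lia. Qed.
Lemma w_bvk_neg n : (w n (bv E k) < 0) = (s n < 0).
Proof. by rewrite (w_bv hb) pmulr_rlt0 //; have := hd k; lia. Qed.

Lemma series_r_axis i a : series_r (bv E' i *+ a) = psi (vq delta q i) a.
Proof.
case: hg => _ hax _.
case: (eqVneq i k) => [->|ik].
  rewrite /series_r (PsiM_r hd mut_compat q1 hpF (N := a.+1)) ?absbxMn // big_ord_recr.
  rewrite big1 ?add0r /= => [|c _].
    rewrite subrr hpF0 mul1r -[q ^ _]/(chi (bv E' k *+ a) (bv E' k *+ a)).
    rewrite (chi_r mut_compat) (linMn (slope_lin _ _ k)) (slope_bvk hd mut_compat) mul0rn mulr0 mul0r.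
    by rewrite expr0z mulr1 add0r.
  change (mbv E k (mcoef b k false) k) with (bv E' k).
  have hc := ltn_ord c; have hca : (0 < a - c)%N by lia.
  rewrite -mulrnBr 1?ltnW // -trel_hop_true (cf_supp hT) ?mul0r //.
  apply: (@bmem_bx_lt0 _ _ _ _ k).
  by rewrite (linMn (bxD E k)) bvk' (linN (bxD E k)) bxv eqxx mulNrn; lia.
have hN : (`|bx E' k (bv E' i *+ a)| < 1)%N by rewrite bxMn eq_sym (negPf ik).
have hN1 : (`|bx E k (bv E i *+ a)| < 1)%N by rewrite bxMn eq_sym (negPf ik).
case: (lerP 0 (b k i)) => hbk.
  rewrite /series_r (PsiM_r hd mut_compat q1 _ hN) big_ord1 mulr0n subr0 bich0r !mulr1.
  rewrite -trel_hop_true /= (bv_pos a ik hbk) -hax (PsiM_l hd hb q1 _ hN1) big_ord1 mulr0n subr0 bich0l mulr1 mul1r.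
  by [].
rewrite series_rE (PsiM_l hd mut_compat q1 _ hN) big_ord1 mulr0n subr0 bich0l mulr1 mul1r.
rewrite -trel_hop_false (tau_bv_neg a ik hbk) -hax -/series_l series_lE.
by rewrite (PsiM_r hd hb q1 _ hN1) big_ord1 mulr0n subr0 bich0r !mulr1.
Qed.

Lemma axis_pos n : axis E n -> 0 <= s n -> n != 0 -> bmem E' n -> axis E' n.
Proof.
case/axisP=> i [a ->]; rewrite s_bvMn bvMn_eq0 => hs a0.
case: (eqVneq i k) => [->|ik].
  move/bmemP/(_ k); rewrite bxk' bxMn eqxx (neg_bound_bvk hd hb); lia.
by move=> _; rewrite -(bv_pos a ik) ?axis_bv //; move: hs; rewrite pmulrn_lge0 // lt0n.
Qed.

Lemma axis_neg n : axis E (tau n) -> s n < 0 -> axis E' n.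
Proof.
case/axisP=> i [a e] hs; have : s (tau n) = b k i *+ a by rewrite e s_bvMn.
rewrite s_tau => es; have hb0 : b k i < 0 by move: hs; rewrite es; case: (a) => [|c]; rewrite ?mulr0n // pmulrn_llt0.
have ik : i != k by apply/eqP => ik; move: hb0; rewrite ik (b_diag hd hb) ltxx.
by rewrite -(tauK n) e -(tau_bv_neg a ik hb0) tauK axis_bv.
Qed.

Lemma logder_series_l n la : lin la -> n != 0 -> ~~ axis E n -> logder la n (zer_part (w n) series_l) = 0.
Proof.
move=> hla n0 hax; case: hg => _ _ hl; case: (boolP (bmem E n)) => hm; first exact: hl.
exact: cf_supp.
Qed.

(** The form [w n] has at e_k the sign of [s n]. For s n > 0 the middle factors of the two series
    agree, for s n < 0 they agree up to [tau], so the conditions on [series_l] carry over. For s n =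
    0 the dilogarithms split off additively and vanish away from the axes. *)
Lemma spec_series_r : spec delta series_r.
Proof.
split; [exact: series_r0 | exact: series_r_axis | move=> n hm n0 hax la hla].
have hlw := sk_lin w n.
case: (ltrgt0P (s n)) => hs.
- have hw : 0 < w n (bv E k) by rewrite w_bvk_pos.
  rewrite (zer_series_r_pos hlw hw).
  have e := rel_logder idD idK idK idw la n (proj1 (zer_uni hlw hT0)) (trel_zer_true hlw).
  rewrite -[LHS]e -(zer_series_l_pos hlw hw) /=; apply: logder_series_l => //.
  by apply: contra hax => hax; apply: axis_pos => //; apply: ltW.
- pose m := tau n; have hlm := sk_lin w m.
  have hw : w n (bv E k) < 0 by rewrite w_bvk_neg.
  have hw' : w m (bv E k) < 0 by rewrite w_bvk_neg s_tau.
  have ew : w m \o tau = w n by apply/funext => x /=; rewrite tauw.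
  have ela : (la \o tau') \o tau = la by apply/funext => x /=; rewrite tauK.
  have hla' : lin (la \o tau').
    by move=> x y /=; rewrite (tau'D tauD tauK tauK') hla.
  rewrite (zer_series_r_neg hlw hw) -ew.
  have e := rel_logder tauD tauK tauK' tauw (la \o tau') n (proj1 (zer_uni hlm hF0)) (trel_zer_false hlm).
  rewrite ela in e; rewrite -[LHS]e -(zer_series_l_neg hlm hw'); apply: logder_series_l => //.
    by apply: contra n0 => /eqP e0; rewrite -(tauK n) e0 /tau' (lin0 (slope_lin E b k)) mulr0z subr0.
  by apply: contra hax => hax; apply: axis_neg.
- have hw : w n (bv E k) = 0 by rewrite (w_bv hb) hs mulr0.
  have u1 : uni (fun m => w n m == 0) Pk.
    by apply: uni_Psi => c hc; rewrite (linMn hlw) hw mul0rn.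
  have u2 : uni (fun m => w n m == 0) Pk'.
    by apply: uni_Psi => c hc; rewrite (linMn hlw) bvk' (linN hlw) hw oppr0 mul0rn.
  have hzp := zer_uni hlw hpF0; have hz := zer_uni hlw hT0.
  have hax' : ~~ axis E n.
    by apply: contra hax => hax; apply: axis_pos => //; rewrite hs.
  rewrite (zer_mul_eqr hlw hpF0 u2) logderM // (logder_Psi w delta hq q1) // addr0.
  have e := rel_logder idD idK idK idw la n (proj1 hz) (trel_zer_true hlw).
  have := logder_series_l hla n0 hax'.
  rewrite /series_l (zer_mul_eql hlw hT0 u1) logderM // (logder_Psi w delta hq q1) // add0r.
  by move=> e'; rewrite -[LHS]e.
Qed.

Lemma zer_pos_transfer th n : lin th -> 0 < th (bv E k) ->
  zer_part th series_l n = zer_part th series_r n.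
Proof.
by move=> ht hk; rewrite (zer_series_l_pos ht hk) (zer_series_r_pos ht hk); apply: (trel_zer_true ht n).
Qed.

Lemma zer_neg_transfer th n : lin th -> th (bv E k) < 0 ->
  zer_part th series_l (tau n) = zer_part (th \o tau) series_r n.
Proof.
move=> ht hk; rewrite (zer_series_l_neg ht hk) (zer_series_r_neg (tau_th ht)) /= ?tau_bvk //.
exact: (trel_zer_false ht n).
Qed.

End Transfer.
End Mutation.

(** * Coefficients on walls and their mutation *)

Section Walls.
Variables (M : zmodType) (I : finType) (w : skewform M) (delta : I -> nat).
Hypothesis hd : forall i, (0 < delta i)%N.
Variables (K : realFieldType) (q : K) (hq : q != 0) (q1 : 1 < q).
Notation chi := (qchi w hq).
Implicit Types (E : basis M I) (b : I -> I -> int) (k l i j : I) (n : M).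

(** The implication makes [cluster] a function of every basis; [cluster_ex] supplies its premise for
    compatible ones. *)
Lemma cluster_cid E : exists g : ser chi (bcone E), (exists g' : ser chi (bcone E), spec delta g') -> spec delta g.
Proof.
by case: (pselect (exists g : ser chi (bcone E), spec delta g)) => [[g hg]|h];
  [exists g | exists 1 => /h].
Qed.

Definition cluster E : ser chi (bcone E) := projT1 (cid (cluster_cid E)).

Lemma cluster_spec E b k : compat w delta E b -> spec delta (cluster E).
Proof.
move=> hb; rewrite /cluster; case: cid => g /=; apply.
by have [u [_ hu]] := cluster_ex hd hb hq q1 k; exists (Psi w E delta hq k * hop delta b k true u).
Qed.

Definition wall E (th : M -> int) n : K := zer_part th (cluster E) n.

Lemma cluster0 E b k : compat w delta E b -> cluster E 0 = 1.
Proof. by move=> hb; case: (cluster_spec k hb). Qed.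

Lemma wall_supp E b k th n : compat w delta E b -> lin th -> wall E th n != 0 ->
  bmem E n /\ th n = 0.
Proof.
move=> hb ht hn; split; first exact: cf_mem hn.
case: (eqVneq n 0) => [->|n0]; first exact: lin0.
by apply/eqP; case: (zer_uni ht (cluster0 k hb)) => _ /(_ n n0 hn).
Qed.

Lemma mul_deg1 E (f g : ser chi (bcone E)) n : f 0 = 1 -> g 0 = 1 -> n != 0 ->
  (bdeg E n <= 1)%N -> (f * g) n = f n + g n.
Proof.
move=> f0 g0 n0 hn.
have hl : low 1 (f - 1).
  move=> m hm; rewrite serBE ser1E; case: (eqVneq m 0) => [->|m0]; first by rewrite f0 subrr.
  rewrite subr0; apply: cf_supp; apply: contra m0 => hm'; apply/eqP.
  by apply: (bdeg_eq0 hm'); move: hm; rewrite /=; lia.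
have -> : f * g = g + (f - 1) * g by rewrite mulrBl mul1r addrCA subrr addr0.
by rewrite serDE (mul_lowl _ hl) // g0 mulr1 serBE ser1E (negPf n0) subr0 addrC.
Qed.

Lemma bdeg_bv E k : bdeg E (bv E k) = 1%N.
Proof.
rewrite /bdeg (bigD1 k) //= bxv eqxx big1 ?addn0 // => i /negPf h.
by rewrite bxv h.
Qed.

(** In degree one the product of series with constant term 1 is additive, and the outer factors have
    no term at e_k because th vanishes there. *)
Lemma wall_bv E b k th : compat w delta E b -> lin th -> th (bv E k) = 0 ->
  wall E th (bv E k) = psi (vq delta q k) 1.
Proof.
move=> hb ht hk; have [g0 hax _] := cluster_spec k hb.
have := hax k 1%N; rewrite mulr1n => <-; rewrite /wall.
have [a [c [ha hx hc e]]] := zer_fac ht g0.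
have n0 := bv_neq0 E k; have hdeg : (bdeg E (bv E k) <= 1)%N by rewrite bdeg_bv.
have [a0 ha'] := ha; have [c0 hc'] := hc; have [x0 _] := hx.
have ax0 : (a * zer_part th (cluster E)) 0 = 1 by rewrite ser0M a0 x0 mulr1.
rewrite [in RHS]e (mul_deg1 ax0 c0 n0 hdeg) (mul_deg1 a0 x0 n0 hdeg).
have -> : a (bv E k) = 0.
  by apply/eqP; apply: contraT => h; have := ha' _ n0 h; rewrite hk ltxx.
have -> : c (bv E k) = 0.
  by apply/eqP; apply: contraT => h; have := hc' _ n0 h; rewrite hk ltxx.
by rewrite add0r addr0.
Qed.

Lemma psi1_neq0 k : psi (vq delta q k) 1 != 0.
Proof.
have v0 := vq_gt0 delta q1 k; have v1 := vq_lt1 hd q1 k.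
have := psiS v0 v1 0; rewrite [psi _ 0]/psi mulr1 => e.
by apply: contraTneq v0 => h; rewrite -e h mul0r ltxx.
Qed.

(** The value v / (v^2 - 1) is injective in v on (0, 1), so the coefficient found on a facet
    remembers [delta]. *)
Lemma psi1_inj k l : psi (vq delta q k) 1 = psi (vq delta q l) 1 -> delta k = delta l.
Proof.
have v0 := vq_gt0 delta q1 k; have v1 := vq_lt1 hd q1 k.
have u0 := vq_gt0 delta q1 l; have u1 := vq_lt1 hd q1 l.
have := psiS v0 v1 0; have := psiS u0 u1 0; rewrite ![psi _ 0]/psi !mulr1 => e1 e2 e.
have : vq delta q k = vq delta q l.
  rewrite e in e2; move: e1 e2 v0 u0; rewrite muln1 !expr2 {e}.
  set p := psi _ 1; clearbody p.
  move: (vq delta q k) (vq delta q l) => x y e1 e2 x0 y0.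
  have h1 : y * (x * x - 1) = x * (y * y - 1).
    transitivity (p * (y * y - 1) * (x * x - 1)); first by rewrite e1.
    by rewrite -mulrA [(y * y - 1) * _]mulrC mulrA e2.
  have h : (x - y) * (x * y + 1) = 0.
    transitivity (y * (x * x - 1) - x * (y * y - 1)); first by ring.
    by rewrite h1 subrr.
  have xy : 0 < x * y + 1 by rewrite addr_gt0 // mulr_gt0.
  by move/eqP: h; rewrite mulf_eq0 (gt_eqF xy) orbF subr_eq0 => /eqP.
rewrite /vq => h; have hq' : 0 < q^-1 by rewrite invr_gt0 (lt_trans _ q1).
have hq1 : q^-1 < 1 by rewrite invf_lt1 // (lt_trans _ q1).
by apply: (ieexprIn hq') h; rewrite lt_eqF.
Qed.

Section Mut.
Variables (E : basis M I) (b : I -> I -> int) (k : I).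
Hypothesis hb : compat w delta E b.
Notation E' := (mut_basis E k (mcoef b k false)).

Lemma cluster_mut : exists u, [/\ uni (reduced E b k) u,
  spec delta (Psi w E delta hq k * hop delta b k true u),
  cluster E = series_l delta b k u & cluster E' = series_r delta b k u].
Proof.
have [u [hu hg]] := cluster_ex hd hb hq q1 k; exists u; split=> //.
  exact: (spec_uniq (cluster_spec k hb) hg).
exact: (spec_uniq (cluster_spec k (mut_compat hd hb k)) (spec_series_r hd hb q1 hu hg)).
Qed.

Lemma wall_pos th n : lin th -> 0 < th (bv E k) -> wall E th n = wall E' th n.
Proof.
move=> ht hk; have [u [hu hg e1 e2]] := cluster_mut.
by rewrite /wall e1 e2; apply: (zer_pos_transfer hd hb q1 hu).
Qed.

Lemma wall_neg th n : lin th -> th (bv E k) < 0 ->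
  wall E th (tau E b k n) = wall E' (th \o tau E b k) n.
Proof.
move=> ht hk; have [u [hu hg e1 e2]] := cluster_mut.
by rewrite /wall e1 e2; apply: (zer_neg_transfer hd hb q1 hu).
Qed.
End Mut.
End Walls.

(** * Chambers along a path of mutations *)

Section Chamber.
Variables (M : zmodType) (I : finType).
Implicit Types (D : basis M I) (th : M -> int) (i j l : I) (n e : M).

Definition chamber D th := lin th /\ forall j, 0 < th (bv D j).

Definition facet D l th :=
  [/\ lin th, th (bv D l) = 0 & forall j, j != l -> 0 < th (bv D j)].

Definition lcomb D (c : I -> int) n : int := \sum_i c i * bx D i n.

Lemma lcomb_lin D c : lin (lcomb D c). Proof. exact: sum_bx_lin. Qed.
Lemma lcomb_bv D c j : lcomb D c (bv D j) = c j. Proof. exact: sum_bx_bv. Qed.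

Lemma lcomb_chamber D c : (forall i, 0 < c i) -> chamber D (lcomb D c).
Proof. by move=> h; split=> [|j]; [exact: lcomb_lin | rewrite lcomb_bv]. Qed.

Lemma lcomb_facet D l : facet D l (lcomb D (fun i => (i != l)%:Z)).
Proof.
split=> [||j jl]; first exact: lcomb_lin; first by rewrite lcomb_bv eqxx.
by rewrite lcomb_bv jl.
Qed.

Definition on_side D (eta : bool) e := forall th, chamber D th -> 0 < sgnz eta * th e.

Lemma sgnz_sq eta : sgnz eta * sgnz eta = 1. Proof. by case: eta. Qed.

Lemma linD th th' : lin th -> lin th' -> lin (fun n => th n + th' n).
Proof. by move=> h h' n m; rewrite h h' addrACA. Qed.
Lemma linZ th a : lin th -> lin (fun n => a * th n).
Proof. by move=> h n m; rewrite h mulrDr. Qed.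

Lemma on_side_coord D eta e j : on_side D eta e -> 0 <= sgnz eta * bx D j e.
Proof.
move=> hs; rewrite leNgt; apply/negP => hneg.
pose T := lcomb D (fun _ => 1) e.
pose N : int := 1 + `|T|.
have hN : 0 < N by rewrite /N; lia.
(* A form far out in the direction of the j-th coordinate: as N exceeds |T|, that coordinate decides
   the sign at e. *)
have /hs : chamber D (fun n => lcomb D (fun _ => 1) n + N * bx D j n).
  split=> [|i]; first by apply: linD; [exact: lcomb_lin | apply: linZ; apply: bxD].
  by rewrite lcomb_bv bxv; case: eqP => _ /=; lia.
rewrite -/T; move: hneg; rewrite /N /sgnz; case: (eta); nia.
Qed.

Lemma facet_coord D eta e l th : on_side D eta e -> facet D l th ->
  0 <= sgnz eta * th e.
Proof.
move=> hs [ht hl hj]; rewrite leNgt; apply/negP => hneg.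
pose N : int := 1 + `|bx D l e|.
have hN : 0 < N by rewrite /N; lia.
have /hs : chamber D (fun n => bx D l n + N * th n).
  split=> [|i]; first by apply: linD; [exact: bxD | apply: linZ].
  rewrite bxv; case: eqVneq => [<-|/eqP li] /=; first by rewrite hl; lia.
  by rewrite add0r mulr_gt0 // hj //; apply/eqP => h; apply: li.
move: hneg; rewrite /N /sgnz; case: (eta); nia.
Qed.

(** In the expansion of [th e] all terms have the sign [eta], so a zero sum kills every coordinate
    on whose basis vector th is positive. *)
Lemma facet_span D eta e l th : on_side D eta e -> facet D l th -> th e = 0 ->
  e = bv D l *~ bx D l e.
Proof.
move=> hs [ht hl hj] he.
have hz j : j != l -> bx D j e = 0.
  move=> jl; have : \sum_i sgnz eta * (bx D i e * th (bv D i)) = 0.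
    by rewrite -mulr_sumr -(lin_bsum D e ht) he mulr0.
  move/eqP; rewrite psumr_eq0 => [/allP/(_ j)|i _].
    rewrite mem_index_enum => /(_ isT); rewrite !mulf_eq0 (gt_eqF (hj _ jl)) orbF.
    by case/orP => /eqP // h; have := sgnz_sq eta; rewrite h mul0r.
  case: (eqVneq i l) => [->|il]; first by rewrite hl !mulr0.
  by rewrite mulrA mulr_ge0 ?(on_side_coord _ hs) // ltW // hj.
rewrite {1}(bsum D e) (bigD1 l) //= big1 ?addr0 // => j jl.
by rewrite hz // mulr0z.
Qed.

(** A form near the common facet lies in the new chamber and keeps the old sign at e, since e is not
    a multiple of [bv D l]. The new chamber is convex and e vanishes nowhere on it, so the sign is
    constant there. *)
Lemma side_step D eta e l (m : I -> int) : on_side D eta e ->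
  (forall j, 0 <= m j) ->
  (exists2 j, j != l & bx D j e != 0) ->
  (forall th, chamber (mut_basis D l m) th -> th e != 0) ->
  on_side (mut_basis D l m) eta e.
Proof.
move=> hs hm [j0 j0l hj0] hne.
have hc j := on_side_coord j hs.
pose f := lcomb D (fun i => (i != l)%:Z).
have f_lin : lin f by exact: lcomb_lin.
have fe : 0 < sgnz eta * f e.
  rewrite /f /lcomb mulr_sumr (bigD1 j0) //= j0l mul1r ltr_wpDr //.
    by rewrite sumr_ge0 // => i _; case: (i != l); rewrite ?mul1r ?mul0r ?mulr0.
  by rewrite lt_neqAle hc andbT eq_sym mulf_neq0 //; case: (eta).
pose N : int := 1 + `|bx D l e| + \sum_i m i.
have mN i : m i < N.
  have : m i <= \sum_j m j by rewrite (bigD1 i) //= lerDl sumr_ge0.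
  by rewrite /N; lia.
have hN : `|bx D l e| < N by have : 0 <= \sum_i m i by [apply: sumr_ge0]; rewrite /N; lia.
(* N exceeds every [m i], which puts [th2] in the new chamber, and exceeds [|bx D l e|], so that f
   decides its sign at e. *)
pose th2 n := N * f n - bx D l n.
have th2c : chamber (mut_basis D l m) th2.
  have hl2 : lin th2.
    by move=> x y; rewrite /th2 f_lin bxD; ring.
  split=> // j; rewrite /= /mbv; case: eqVneq => [_|jl].
    by rewrite (linN hl2) /th2 /f lcomb_bv bxv eqxx mulr0.
  rewrite hl2 (linMz _ _ hl2) /th2 /f !lcomb_bv !bxv jl !eqxx eq_sym (negPf jl) /=.
  by have := mN j; lia.
have h2 : 0 < sgnz eta * th2 e by rewrite /th2; move: fe hN; rewrite /sgnz; case: (eta); nia.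
move=> th hth; have hn0 : sgnz eta * th e != 0.
  by apply: mulf_neq0; [case: (eta) | exact: hne].
rewrite lt_neqAle eq_sym hn0 /=.
rewrite leNgt; apply/negP => hneg.
pose A := `|th e|; pose B := `|th2 e|.
have hA : 0 < A by rewrite normr_gt0 hne.
have hB : 0 < B by rewrite normr_gt0 hne.
(* With opposite signs at e, these weights give a point of the segment where e vanishes. *)
have : chamber (mut_basis D l m) (fun n => B * th n + A * th2 n).
  case: hth => t1 t2; case: th2c => t3 t4; split; first by apply: linD; apply: linZ.
  by move=> j; rewrite addr_gt0 // mulr_gt0.
move/hne; case/eqP; rewrite /A /B; move: hneg h2; rewrite /sgnz; case: (eta); nia.
Qed.

End Chamber.

(** * Induction along a path of mutations *)

Section Pattern.
Variables (M : zmodType) (I : finType) (w : skewform M) (delta : I -> nat).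
Hypothesis hd : forall i, (0 < delta i)%N.
Variables (K : realFieldType) (q : K) (hq : q != 0) (q1 : 1 < q).
Implicit Types (E D : basis M I) (b : I -> I -> int) (k l i j : I) (n : M)
  (th : M -> int) (ks : seq I).
Notation wall := (wall w delta hq).
Notation psi1 l := (psi (vq delta q l) 1).

(* Vectors are mutated with their own tropical sign, which is the c-vector rule once
   sign-coherence is known. *)
Definition cstep E (st : (I -> I -> int) * basis M I) l :=
  (mutb l st.1, mut_basis st.2 l (mcoef st.1 l (bmem E (bv st.2 l)))).

Definition run E b ks := foldl (cstep E) (b, E) ks.

Lemma run_rcons E b ks l : run E b (rcons ks l) = cstep E (run E b ks) l.
Proof. by rewrite /run -cats1 foldl_cat. Qed.

Lemma run_b E b ks : (run E b ks).1 = foldl (fun c l => mutb l c) b ks.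
Proof.
elim/last_ind: ks => [|ks l IH] //.
by rewrite run_rcons /= IH -[in RHS]cats1 foldl_cat.
Qed.

Lemma run_compat E b ks : compat w delta E b ->
  compat w delta (run E b ks).2 (run E b ks).1.
Proof.
move=> hb; elim/last_ind: ks => [|ks l IH] //.
by rewrite run_rcons; apply: compat_mut.
Qed.

Definition sgv (eps : bool) n : M := if eps then n else - n.

Definition shear E b k (eta : bool) n := if eta then n else tau E b k n.

Definition claim_chamber E b ks := forall th, chamber (run E b ks).2 th ->
  forall n, n != 0 -> wall E th n = 0.
Definition claim_facet E b ks := forall l th, facet (run E b ks).2 l th ->
  exists eps, wall E th (sgv eps (bv (run E b ks).2 l)) = psi1 l.
(** Change of base point: the basis reached from E through k is the one reached from the mutated
    basis, unchanged if its chamber lies on the positive side of the wall of e_k and sheared by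
    [tau] on the negative side. *)
Definition claim_shear E b k ks := exists eta,
  on_side (run E b (k :: ks)).2 eta (bv E k) /\
  forall j, bv (run E b (k :: ks)).2 j =
    shear E b k eta (bv (run (mut_basis E k (mcoef b k false)) (mutb k b) ks).2 j).

Lemma mcoef_ge0 b k sg i : 0 <= mcoef b k sg i.
Proof. by rewrite /mcoef /pospart; case: ifP. Qed.

Lemma claim_nil E b : compat w delta E b -> claim_chamber E b [::] /\ claim_facet E b [::].
Proof.
move=> hb; split.
  move=> th [ht hp] n n0; apply/eqP; apply: contraNT n0 => hn; apply/eqP.
  apply: (bx_inj (E := E)) => i; rewrite (lin0 (bxD E i)).
  have [/bmemP hm hz] := wall_supp hd q1 i hb ht hn.
  move/eqP: hz; rewrite (lin_bsum E n ht) psumr_eq0 => [/allP/(_ i)|j _].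
    by rewrite mem_index_enum mulf_eq0 (gt_eqF (hp i)) orbF => /(_ isT)/eqP.
  by rewrite mulr_ge0 // ltW // hp.
by move=> l th [ht hl _]; exists true; rewrite /= (wall_bv hd hq q1 hb ht hl).
Qed.

Section Step.
Variables (E : basis M I) (b : I -> I -> int) (k : I).
Hypothesis hb : compat w delta E b.
Notation E' := (mut_basis E k (mcoef b k false)).
Notation b' := (mutb k b).
Notation L := (shear E b k).

Lemma shearD eta n m : L eta (n + m) = L eta n + L eta m.
Proof. by case: eta => //=; apply: tauD. Qed.
Lemma shearN eta n : L eta (- n) = - L eta n.
Proof. by case: eta => //=; apply: (tauN (tauD E b k)). Qed.
Lemma shearMz eta n z : L eta (n *~ z) = L eta n *~ z.
Proof.
have hMn a : L eta (n *+ a) = L eta n *+ a.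
  elim: a => [|a IH]; last by rewrite !mulrS shearD IH.
  by rewrite !mulr0n; case: (eta) => //=; apply: (tau0 (tauD E b k)).
by case: z => a; rewrite ?NegzE ?mulrNz -?pmulrn ?shearN hMn.
Qed.
Lemma shear_bvk eta : L eta (bv E k) = bv E k.
Proof. by case: eta => //=; apply: (tau_bvk hd hb). Qed.
Lemma shear_bx eta i n : i != k -> bx E i (L eta n) = bx E i n.
Proof.
case: eta => // /negPf ik; rewrite /= /tau bxD (linMz _ _ (bxD E i)) bxv ik.
by rewrite mulr0 addr0.
Qed.
Lemma shear_lin eta th : lin th -> lin (th \o L eta).
Proof. by move=> ht n m /=; rewrite shearD ht. Qed.
Lemma shear_inv eta : exists L', cancel (L eta) L' /\ cancel L' (L eta).
Proof.
case: eta; first by exists id.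
by exists (tau' E b k); split; [exact: (tauK hd hb) | exact: (tauK' hd hb)].
Qed.

Lemma wall_shear eta th n : lin th -> 0 < sgnz eta * th (bv E k) ->
  wall E th (L eta n) = wall E' (th \o L eta) n.
Proof.
case: eta => ht; rewrite /sgnz ?mul1r ?mulN1r ?oppr_gt0 => h.
  exact: (wall_pos hd hq q1 hb).
exact: (wall_neg hd hq q1 hb).
Qed.

(** Off the wall of e_k, [wall_shear] relates the coefficients and the shear matches the chambers.
    Only a facet contained in that wall needs a separate argument. *)
Lemma claims_of_shear ks : claim_shear E b k ks ->
  claim_chamber E' b' ks -> claim_facet E' b' ks ->
  claim_chamber E b (k :: ks) /\ claim_facet E b (k :: ks).
Proof.
rewrite /claim_shear /claim_chamber /claim_facet.
set D := (run E b (k :: ks)).2; set D' := (run E' b' ks).2.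
case=> eta [hs hL] hc hf; have [L' [LK LK']] := shear_inv eta.
have L0 : L eta 0 = 0 by apply: (addrI (L eta 0)); rewrite -shearD !addr0.
split=> [th hth n n0|l th hth].
  have [ht hp] := hth; rewrite -(LK' n) wall_shear ?hs //; apply: hc.
    by split=> [|j /=]; [exact: shear_lin | rewrite -hL].
  by apply: contra n0 => /eqP e; rewrite -(LK' n) e L0.
have [ht hl hp] := hth.
have hth' : facet D' l (th \o L eta).
  split=> [||j jl] /=; first exact: shear_lin; first by rewrite -hL.
  by rewrite -hL hp.
have [eps he] := hf l _ hth'.
have hsg n : L eta (sgv eps n) = sgv eps (L eta n).
  by case: (eps) => //=; rewrite shearN.
case: (eqVneq (th (bv E k)) 0) => hk; last first.
  exists eps; rewrite hL -hsg wall_shear // lt_neqAle (facet_coord hs hth) andbT eq_sym.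
  by apply: mulf_neq0 => //; case: (eta).
(* The facet lies in the wall of e_k, so e_k is an integer multiple of [bv D l]; the factor divides
   the k-th coordinate 1 of e_k, hence is 1 or -1. *)
have ek := facet_span hs hth hk; set a := bx D l (bv E k) in ek.
have ha : bx E k (bv E k) = a * bx E k (bv D l) by rewrite {1}ek (linMz _ _ (bxD E k)).
rewrite bxv eqxx /= in ha.
have [e1 ee] : exists e1, bv E k = sgv e1 (bv D l).
  have [h|h] : a = 1 \/ a = -1.
      move/(congr1 absz): ha; rewrite abszM => /esym/eqP.
      by rewrite muln_eq1 => /andP[/eqP h _]; lia.
    by exists true; rewrite /sgv ek h mulr1z.
  by exists false; rewrite /sgv ek h mulrN1z.
exists e1; rewrite -ee (wall_bv hd hq q1 hb ht hk).
(* It remains to identify [psi1 k] with [psi1 l]. This is read off in the mutated basis, where the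
   facet vector is e'_k up to sign. *)
have hb1 := mut_compat hd hb k.
have nz : wall E' (th \o L eta) (sgv eps (bv D' l)) != 0 by rewrite he; apply: (psi1_neq0 hd q1).
have [hm _] := wall_supp hd q1 k hb1 (shear_lin eta ht) nz.
have hD' : bv D' l = sgv (~~ e1) (bv E' k).
  have hDl : bv D l = sgv e1 (bv E k) by rewrite ee; case: (e1); rewrite /= ?opprK.
  apply: (can_inj LK); rewrite -hL hDl bvk'.
  by case: (e1); rewrite /= ?opprK ?shearN shear_bvk.
have : sgv eps (bv D' l) = bv E' k.
  move: hm; rewrite hD'; case: (eps) (e1) => [] []; rewrite /= ?opprK //.
    by move=> /bmemP/(_ k); rewrite (linN (bxD E' k)) bxv eqxx.
  by move=> /bmemP/(_ k); rewrite (linN (bxD E' k)) bxv eqxx.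
move=> e2; rewrite -he e2 (wall_bv hd hq q1 hb1 (shear_lin eta ht)) //.
by rewrite bvk' /= shearN shear_bvk (linN ht) hk oppr0.
Qed.
(** A nonzero coefficient of a series supported in the cone has its exponent in the cone: this is
    where sign-coherence is obtained. *)
Lemma facet_sign E1 b1 ks l : compat w delta E1 b1 -> claim_facet E1 b1 ks ->
  exists eps, bmem E1 (sgv eps (bv (run E1 b1 ks).2 l)) /\
    wall E1 (lcomb (run E1 b1 ks).2 (fun i => (i != l)%:Z))
      (sgv eps (bv (run E1 b1 ks).2 l)) = psi1 l.
Proof.
move=> hb1 /(_ l _ (lcomb_facet _ l))[eps he]; exists eps; split=> //.
have nz : psi1 l != 0 by apply: (psi1_neq0 hd q1).
rewrite -he in nz.
by have [] := wall_supp hd q1 l hb1 (lcomb_lin _ _) nz.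
Qed.

(** The first step from E uses the positive sign, as e_k lies in its own cone, whereas E' is formed
    with the other sign; the two differ by [tau]. *)
Lemma shear_nil : claim_shear E b k [::].
Proof.
exists false; split=> [th [ht hp]|j].
  by have := hp k; rewrite /= /mbv eqxx (linN ht) /sgnz; lia.
have -> : run E b [:: k] = cstep E (b, E) k by [].
have hm : bmem E (bv E k) by have := bmem_bvMn E k 1; rewrite mulr1n.
rewrite /cstep /= hm /mbv; case: eqVneq => [_|jk].
  by rewrite -[tau E b k]/(L false) shearN shear_bvk.
rewrite -[tau E b k]/(L false) shearD shearMz shear_bvk /= /tau slope_bv.
by rewrite /mcoef [pospart (b k j)]pospartE mulrzDr addrA addrAC.
Qed.

(* The tropical signs in E and in E' differ only when the c-vector is plus or minus e_k,
   that is when the path crosses the wall of e_k and the shear changes as well. *)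
Lemma shear_rcons r l : claim_shear E b k r -> claim_facet E b (k :: r) ->
  claim_facet E' b' r -> claim_chamber E' b' (rcons r l) ->
  claim_shear E b k (rcons r l).
Proof.
move=> [eta [hs hL]] hf hf' hc.
have hb1 := mut_compat hd hb k.
have hbt := run_compat (k :: r) hb; have hbt' := run_compat r hb1.
have [eps [hm hw]] := facet_sign l hb hf.
have [eps' [hm' hw']] := facet_sign l hb1 hf'.
rewrite /claim_chamber run_rcons in hc.
rewrite /claim_shear -rcons_cons !run_rcons.
have ebt : (run E b (k :: r)).1 = (run E' b' r).1 by rewrite !run_b.
move: hs hL hbt hbt' hm hw hm' hw' hc; rewrite /cstep ebt.
set D := (run E b (k :: r)).2; set D' := (run E' b' r).2; set bt := (run E' b' r).1.
move=> hs hL hbt hbt' hm hw hm' hw' hc /=.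
have [L' [LK LK']] := shear_inv eta.
have hs' : on_side D' eta (bv E k).
  move=> th [ht hp].
  have hL' n m : L' (n + m) = L' n + L' m by apply: (can_inj LK); rewrite shearD !LK'.
  have -> : th (bv E k) = (th \o L') (bv E k) by rewrite /= -{2}(shear_bvk eta) LK.
  apply: hs; split=> [n m|j] /=; first by rewrite hL' ht.
  by rewrite hL LK.
case: (boolP [exists i, (i != k) && (bx E i (bv D l) != 0)]) => hex.
  have [i /andP[ik hi]] := existsP hex.
  have e1 : bx E' i (bv D' l) = bx E i (bv D l) by rewrite bxi' // hL shear_bx.
  (* The sign of a sign-coherent vector shows in any nonzero coordinate, and the i-th one is
     untouched by the shear and by the change of basis. *)
  have esg : bmem E (bv D l) = bmem E' (bv D' l).
    have pos (E1 : basis M I) (x : M) ee : bmem E1 (sgv ee x) -> bx E1 i x != 0 ->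
        bmem E1 x = (0 < bx E1 i x).
      case: ee => /= h hx.
        by rewrite h lt_neqAle eq_sym hx (elimT (bmemP _ _) h).
      have := elimT (bmemP _ _) h i; rewrite (linN (bxD E1 i)) => h1.
      have h2 : bx E1 i x < 0 by lia.
      by rewrite (negPf (bmem_bx_lt0 h2)); lia.
    by rewrite (pos _ _ _ hm hi) (pos _ _ _ hm') e1.
  have hnew j : mbv D l (mcoef bt l (bmem E (bv D l))) j =
      L eta (mbv D' l (mcoef bt l (bmem E' (bv D' l))) j).
    rewrite esg /mbv; case: eqVneq => _; first by rewrite shearN hL.
    by rewrite shearD shearMz !hL.
  exists eta; split=> //.
  have hside : on_side (mut_basis D' l (mcoef bt l (bmem E' (bv D' l)))) eta (bv E k).
    apply: side_step => //; first by move=> j; apply: mcoef_ge0.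
      apply: contrapT => hno; case/negP: hi; apply/eqP.
      have ek : bv E k = bv D' l *~ bx D' l (bv E k).
        rewrite {1}(bsum D' (bv E k)) (bigD1 l) //= big1 ?addr0 // => j jl.
        case: (eqVneq (bx D' j (bv E k)) 0) => [->|h]; first by rewrite mulr0z.
        by case: hno; exists j.
      have := congr1 (bx E' i) ek; rewrite (linMz _ _ (bxD E' i)) e1 bxi' // bxv (negPf ik).
      move/esym/eqP; rewrite mulf_eq0 => /orP[/eqP h|/eqP //].
      by move: ek; rewrite h mulr0z => /eqP; rewrite (negPf (bv_neq0 E k)).
    (* If th vanished at e_k, the middle factor would have a nonzero coefficient at e'_k, against
       its triviality on the new chamber. *)
    move=> th hth; apply/eqP => hk; have [ht _] := hth.
    have hk' : th (bv E' k) = 0 by rewrite bvk' (linN ht) hk oppr0.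
    have := hc th hth (bv E' k) (bv_neq0 E' k).
    by rewrite (wall_bv hd hq q1 hb1 ht hk') => /eqP; rewrite (negPf (psi1_neq0 hd q1 k)).
  move=> th [ht hp]; have := hside (th \o L eta); rewrite /= shear_bvk; apply.
  by split=> [|j] /=; [exact: shear_lin | rewrite -hnew; apply: hp].
have hz i : i != k -> bx E i (bv D l) = 0.
  move=> ik; apply/eqP; move: hex; rewrite negb_exists => /forallP/(_ i).
  by rewrite ik negbK.
have eDl : bv D l = bv E k *~ bx E k (bv D l).
  rewrite {1}(bsum E (bv D l)) (bigD1 k) //= big1 ?addr0 // => i ik.
  by rewrite hz // mulr0z.
have eDs : bv D l = sgv eta (bv E k).
  have := hs _ (@lcomb_chamber _ _ D (fun _ => 1) (fun _ => ltr01)); rewrite -/D => h1.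
  have h2 : lcomb D (fun _ => 1) (bv D l) = 1 by rewrite lcomb_bv.
  move: h2; rewrite {1}eDl (linMz _ _ (lcomb_lin _ _)) => h2.
  rewrite eDl; move: h1 h2; move: (bx E k (bv D l)) (lcomb D _ (bv E k)) => a z h1 h2.
  have ha : `|a|%N = 1%N.
    by move/(congr1 absz): h2; rewrite abszM => /eqP; rewrite muln_eq1 => /andP[/eqP].
  have [ea|ea] : a = 1 \/ a = -1 by lia.
    by move: h1 h2; rewrite ea mulr1z mul1r /sgnz => + h2; rewrite h2; case: (eta).
  by move: h1 h2; rewrite ea mulrN1z /sgnz; case: (eta) => //=; lia.
have eDl' : bv D' l = sgv (~~ eta) (bv E' k).
  apply: (can_inj LK); rewrite -hL eDs bvk'.
  have h1 : L eta (- bv E k) = - bv E k by rewrite shearN shear_bvk.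
  by move: h1; case: (eta) => /= h1; rewrite ?opprK.
have mE : bmem E (bv D l) = eta.
  rewrite eDs; case: (eta) => /=; first by have := bmem_bvMn E k 1; rewrite mulr1n.
  by apply/negP => /bmemP/(_ k); rewrite (linN (bxD E k)) bxv eqxx.
have mE' : bmem E' (bv D' l) = ~~ eta.
  rewrite eDl'; case: (eta) => /=; last by have := bmem_bvMn E' k 1; rewrite mulr1n.
  by apply/negP => /bmemP/(_ k); rewrite (linN (bxD E' k)) bxv eqxx.
(* The coefficient at this vector is [psi1 l] as a facet value and [psi1 k] as an axis value. Equal
   symmetrizers turn slopes along e_k into entries of row l of [bt]. *)
have edelta : delta k = delta l.
  apply: (psi1_inj hd q1); rewrite -hw.
  have -> : sgv eps (bv D l) = bv E k.
    move: hm; rewrite eDs; case: (eps) (eta) => [] []; rewrite /= ?opprK //.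
      by move=> /bmemP/(_ k); rewrite (linN (bxD E k)) bxv eqxx.
    by move=> /bmemP/(_ k); rewrite (linN (bxD E k)) bxv eqxx.
  symmetry; apply: (wall_bv hd hq q1 hb (lcomb_lin _ _)).
  have := lcomb_bv D (fun i => (i != l)%:Z) l; rewrite eqxx eDs.
  by case: (eta) => //=; rewrite (linN (lcomb_lin _ _)) => /eqP; rewrite oppr_eq0 => /eqP.
have sD j : slope E b k (bv D j) = sgnz eta * bt l j.
  have hdk : (delta k)%:Z != 0 by have := hd k; lia.
  apply: (mulfI hdk); rewrite -(w_bv hb).
  have : w (bv D j) (bv D l) = (delta l)%:Z * bt l j by rewrite hbt (compatC hbt) opprK.
  rewrite eDs edelta; case: (eta) => /= [->|]; first by rewrite mul1r.
  by rewrite (linN (sk_lin w _)) => /eqP; rewrite eqr_oppLR => /eqP ->; rewrite mulN1r mulrN.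
exists (~~ eta); split.
  move=> th [ht hp]; have := hp l; rewrite /= /mbv eqxx eDs.
  by case: (eta) => /=; rewrite ?opprK ?(linN ht) /sgnz; lia.
move=> j; rewrite /mbv mE mE'; case: eqVneq => jl.
  have h1 : L (~~ eta) (- bv E k) = - bv E k by rewrite shearN shear_bvk.
  by move: h1; rewrite eDs eDl' bvk'; case: (eta) => /= h1; rewrite ?opprK ?h1.
(* The two mutations use opposite signs; their difference [bt l j] is the slope of [bv D j] up to
   sign, which is exactly the change of shear. *)
move: (sD j) (hL j); rewrite eDs eDl' bvk' /mcoef; case: (eta) => /=.
  move=> hsj ej; rewrite -ej opprK -[tau E b k]/(L false) shearD shearMz shear_bvk.
  by rewrite /= /tau hsj /sgnz mul1r [pospart (bt l j)]pospartE mulrzDr addrA addrAC.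
move=> hsj ej; rewrite ej.
have : slope E b k (bv D' j) = - bt l j.
  by rewrite -(s_tau hd hb) -ej hsj /sgnz mulN1r.
rewrite /tau => ->; rewrite -addrA; congr (_ + _).
by rewrite [pospart (bt l j)]pospartE !mulNrz mulrzDr opprD mulrNz addrC.
Qed.
End Step.

(** Extending k :: r by a letter needs only claims for shorter paths, but at both E and its mutation
    at k. Hence one induction on length, over all bases and all three claims. *)
Lemma all_claims ks E b : compat w delta E b -> claim_chamber E b ks /\ claim_facet E b ks.
Proof.
move=> hb.
suff H N : forall ks E b, compat w delta E b -> (size ks <= N)%N ->
    [/\ claim_chamber E b ks, claim_facet E b ks &
        forall k r, ks = k :: r -> claim_shear E b k r].
  by have [] := H (size ks) ks E b hb (leqnn _).
elim: N => [|N IH] {ks E b hb} ks E b hb hN.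
  by case: ks hN => // _; have [] := claim_nil hb.
case: ks hN => [|k r] hN; first by have [] := claim_nil hb.
have hb1 := mut_compat hd hb k.
have hsh : claim_shear E b k r.
  case/lastP: r hN => [|r l] hN; first exact: shear_nil.
  rewrite /= size_rcons in hN.
  have [_ hf hs] := IH (k :: r) E b hb hN.
  have [_ hf' _] := IH r _ _ hb1 (ltnW hN).
  have hN' : (size (rcons r l) <= N)%N by rewrite size_rcons.
  have [hc _ _] := IH (rcons r l) _ _ hb1 hN'.
  by apply: shear_rcons => //; apply: hs.
have [hc hf _] := IH r _ _ hb1 hN.
have [h1 h2] := claims_of_shear hb hsh hc hf.
by split=> // k' r' [<- <-].
Qed.
End Pattern.

(** * c-vectors of the pattern with principal coefficients *)

Section TropicalSum.
Variables (n : nat) (d : 'I_n -> nat) (eps : bool) (k l : 'I_n) (yk : trop n).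
Notation a := (sgnz eps * yexp yk l).

Lemma yexp_tmul (x y : trop n) : yexp (tmul x y) l = yexp x l + yexp y l.
Proof. by []. Qed.
Lemma yexp_tpow (x : trop n) e : yexp (tpow x e) l = yexp x l * e.
Proof. by []. Qed.
Lemma yexp_tplus (x y : trop n) : yexp (tplus x y) l = Num.min (yexp x l) (yexp y l).
Proof. by []. Qed.

Lemma yexp_zgen s : yexp (zgen d k s) l = 0.
Proof. by rewrite /zgen; case: ifP. Qed.

(** The exponents a s are monotone in s, so the minimum sits at s = 0 or s = d_k; frozen variables
    carry no y-exponent. *)
Lemma yexp_zsum : (0 < d k)%N ->
  yexp (zsum d eps k yk) l = if 0 <= a then 0 else a * (d k)%:Z.
Proof.
move=> dk; rewrite /zsum.
set f := fun s => tmul (zgen d k s) _; set z := tmul _ _.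
have e0 : yexp z l = 0 by rewrite yexp_tmul yexp_zgen yexp_tpow mulr0.
have es s : yexp (f s) l = a * s%:Z.
  by rewrite yexp_tmul yexp_zgen yexp_tpow add0r; ring.
clearbody f z; case: ifPn => ha.
  elim: (iota 1 (d k)) => [|s r IH]; first exact: e0.
  rewrite [map _ _]/= [foldr _ _ _]/= yexp_tplus IH es.
  by apply/min_idPr; rewrite mulr_ge0.
have key N m : yexp (foldr (@tplus n) z [seq f s | s <- iota m N.+1]) l = a * (m + N)%:Z.
  elim: N m => [|N IH] m.
    rewrite [map _ _]/= [foldr _ _ _]/= yexp_tplus es e0 addn0; apply/min_idPl.
    by rewrite -ltNge in ha; nia.
  rewrite [iota _ _]/= [map _ _]/= [foldr _ _ _]/= yexp_tplus es.
  rewrite -/(iota m.+1 N.+1) -/[seq f s | s <- iota m.+1 N.+1] in IH *.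
  rewrite (IH m.+1) addSnnS; apply/min_idPr; nia.
by case: (d k) dk => // N _; rewrite key add1n.
Qed.

(** When [eps] disagrees with the sign of the component, the sum supplies the missing multiple of B.
    What remains is the standard rule for d_k B, independent of [eps], with a sign chosen per
    component. *)
Lemma yexp_step x B : (0 < d k)%N ->
  x + yexp yk l * pospart (sgnz eps * B) * (d k)%:Z + yexp (zsum d eps k yk) l * - B =
  x + yexp yk l * pospart (if 0 <= yexp yk l then (d k)%:Z * B else - ((d k)%:Z * B)).
Proof.
move=> dk; rewrite yexp_zsum //; move: (yexp yk l) => y.
have hp z : pospart ((d k)%:Z * z) = (d k)%:Z * pospart z by apply: pospart_pmul.
rewrite -mulrN; have -> : (if 0 <= y then (d k)%:Z * B else (d k)%:Z * - B) =
  (d k)%:Z * (if 0 <= y then B else - B) by case: ifP.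
rewrite hp; case: eps; rewrite /sgnz ?mul1r ?mulN1r ?oppr_ge0.
  case: (lerP 0 y) => hy; first by ring.
  by rewrite [pospart B]pospartE; ring.
case: (ltrgt0P y) => hy; last by rewrite hy; ring.
  by rewrite [pospart B]pospartE; ring.
by ring.
Qed.
End TropicalSum.

(** * The matrix pattern as a path of lattice bases *)

Section Standard.
Variables (n : nat) (B : 'M[int]_n) (d : 'I_n -> nat) (eps : bool) (delta : 'I_n -> nat).
Hypotheses (hd : forall i, (0 < d i)%N) (hdelta : forall i, (0 < delta i)%N).
Hypothesis hB : forall i j, (delta i)%:Z * B i j = - ((delta j)%:Z * B j i).

Definition bhat (A : 'M[int]_n) : 'I_n -> 'I_n -> int := fun i j => (d i)%:Z * A i j.
(** An integral form of delta_i / d_i, the symmetrizer of the matrix d_i b_ij: [dhat i * d i] is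
    [delta i] times the product of all d_j. *)
Definition dhat (i : 'I_n) : nat := (delta i * \prod_(j | j != i) d j)%N.

Lemma dhat_gt0 i : (0 < dhat i)%N.
Proof. by rewrite muln_gt0 hdelta prodn_cond_gt0. Qed.

Lemma dhat_bhat i j :
  (dhat i)%:Z * bhat B i j = (delta i)%:Z * B i j * (\prod_j d j)%:Z.
Proof. by rewrite /dhat /bhat [in RHS](bigD1 i) //= !PoszM; ring. Qed.

Definition wstd (x y : 'rV[int]_n) : int :=
  \sum_i \sum_j - ((dhat i)%:Z * bhat B i j) * x 0 i * y 0 j.

Lemma wstdDl x y z : wstd (x + y) z = wstd x z + wstd y z.
Proof.
rewrite /wstd -big_split /=; apply: eq_bigr => i _; rewrite -big_split /=.
by apply: eq_bigr => j _; rewrite mxE; ring.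
Qed.

Lemma wstdC x y : wstd x y = - wstd y x.
Proof.
rewrite /wstd exchange_big -sumrN; apply: eq_bigr => i _ /=.
rewrite -sumrN; apply: eq_bigr => j _; rewrite !dhat_bhat hB; ring.
Qed.

Definition wform : skewform 'rV[int]_n := Skewform wstdDl wstdC.

Lemma std_bxD (i : 'I_n) : lin (fun x : 'rV[int]_n => x 0 i).
Proof. by move=> x y; rewrite mxE. Qed.
Lemma std_bxv (i j : 'I_n) : (delta_mx 0 j : 'rV[int]_n) 0 i = (i == j)%:Z.
Proof. by rewrite mxE eqxx; case: eqP. Qed.
Lemma std_bsum (x : 'rV[int]_n) : x = \sum_i delta_mx 0 i *~ x 0 i.
Proof.
rewrite {1}[x]row_sum_delta; apply: eq_bigr => i _.
by rewrite -scaler_int intz.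
Qed.

Definition std : basis 'rV[int]_n 'I_n := Basis std_bxD std_bxv std_bsum.

Lemma std_compat : compat wform dhat std (bhat B).
Proof.
move=> i j; rewrite /= /wstd (bigD1 i) //= (bigD1 j) //= !mxE !eqxx /=.
rewrite big1 => [|l /negPf lj]; last by rewrite !mxE lj mulr0.
rewrite big1 => [|l /negPf li]; last by rewrite big1 // => m _; rewrite !mxE li mulr0 mul0r.
by ring.
Qed.

Lemma run_sign ks j : exists sg,
  bmem std (sgv sg (bv (run std (bhat B) ks).2 j)).
Proof.
(* The conclusion does not mention q, so any convenient value above 1 serves. *)
have q1 : 1 < 2%:R :> rat by rewrite ltr1n.
have hq : 2%:R != 0 :> rat by rewrite pnatr_eq0.
have [_ hf] := all_claims dhat_gt0 hq q1 ks std_compat.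
by have [sg [h _]] := facet_sign dhat_gt0 q1 j std_compat hf; exists sg.
Qed.

Lemma bhat_mutB k (A : 'M[int]_n) : bhat (mutB d k A) = mutb k (bhat A).
Proof.
apply/funext => i; apply/funext => j; rewrite /bhat /mutb mxE.
case: ifP => _; first by rewrite mulrN.
by rewrite -mulrN !pospart_pmul; ring.
Qed.

(** The pattern mutates each component by its own sign, [run] the whole vector by one sign.
    [run_sign], established for [run] independently of the pattern, shows that the two rules
    agree. *)
Lemma seed_run ks : bhat (seed_at d eps B ks).1 = (run std (bhat B) ks).1 /\
  forall i j, yexp ((seed_at d eps B ks).2 j) i = bv (run std (bhat B) ks).2 j 0 i.
Proof.
elim/last_ind: ks => [|ks l [IH1 IH2]].
  by split=> // i j; rewrite /= mxE eqxx; case: eqP.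
have [sg hsg] := run_sign ks l.
rewrite run_rcons /seed_at -cats1 foldl_cat -/(seed_at d eps B ks).
move: hsg IH1 IH2; case: (run std (bhat B) ks) => bt D; case: (seed_at d eps B ks) => A Y.
rewrite /= => hsg <- IH2; split=> [|i j]; first exact: bhat_mutB.
rewrite /mutY /mbv; case: eqVneq => [_|jl].
  by rewrite yexp_tpow IH2 mxE mulrN1.
rewrite !yexp_tmul !yexp_tpow yexp_step // IH2 !mxE -scaler_int intz mxE IH2.
congr (_ + _); rewrite mulrC.
(* A zero component counts as nonnegative even in a nonpositive vector, but its increment vanishes
   for either sign. *)
case: (eqVneq (bv D l 0 i) 0) => [->|hnz]; first by rewrite !mulr0.
congr (_ * _); rewrite /mcoef /bhat; congr pospart.
have -> : bmem std (bv D l) = (0 <= bv D l 0 i); last by case: ifP.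
case: sg hsg => /= /bmemP hm; have := hm i; rewrite /= ?mxE => hi.
  by rewrite hi; apply/bmemP.
have hi' : (0 <= bv D l 0 i) = false by lia.
by rewrite hi'; apply/negP => /bmemP/(_ i); rewrite /= hi'.
Qed.

Lemma cvec_sign_coherent ks j : sign_coherent (cvec d eps B ks j).
Proof.
have [_ hY] := seed_run ks; have [sg hsg] := run_sign ks j.
have hc i : cvec d eps B ks j i = bv (run std (bhat B) ks).2 j 0 i by apply: hY.
split.
  apply: contrapT => hno; have /eqP[] := bv_neq0 (run std (bhat B) ks).2 j.
  apply/rowP => i; rewrite -hc mxE; apply/eqP; apply: contraT => h.
  by case: hno; exists i.
case: sg hsg => /bmemP hm; [left | right] => i; have := hm i; rewrite hc /= ?mxE //.
by rewrite oppr_ge0.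
Qed.
End Standard.

Theorem mainTheorem15 (n : nat) (B : 'M[int]_n) (d : 'I_n -> nat) (eps : bool)
    (ks : seq 'I_n) (j : 'I_n) :
  skew_symmetrizable B -> (forall i, (0 < d i)%N) -> tree_vertex ks ->
  sign_coherent (cvec d eps B ks j).
Proof.
move=> [delta [hdelta hB]] hd _.
exact: (cvec_sign_coherent eps hd hdelta hB).
Qed.
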